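(* Let $G$ be a finite-horizon dynamic game with perfect information, without Nature, with active players $I=\{1,\dots,n\}$, satisfying the no indifference condition: for any two histories $h_\infty,h'_\infty\in H_\infty$, if $u_i(h_\infty)=u_i(h'_\infty)$ for some $i\in I$, then $u_j(h_\infty)=u_j(h'_\infty)$ for every $j\in I$. Then every mixed-strategy subgame-perfect equilibrium $f=\{f_1,\dots,f_n\}$ of $G$ has the no-mixing property: every pure-strategy profile $g=\{g_1,\dots,g_n\}$ satisfying $g_{ti}(h_{t-1})\in \operatorname{support}(f_{ti}(\cdot|h_{t-1}))$ for all $t\ge 1$, $i\in I$ and $h_{t-1}\in H_{t-1}$ is a subgame-perfect equilibrium of $G$.
   Context: **Dynamic game with perfect information.** The set of active players is $I=\{1,\dots,n\}$; player $0$ is Nature and $I_0=I\cup\{0\}$. Stages are $t=0,1,2,\dots$. The set of starting points is $H_0=X_0\times S_0$, with $X_0$ a compact metric space and $S_0$ a Polish space. For $t\ge1$ let $X_{ti}$ ($i\in I$) and $S_t$ be Polish spaces, $X_t=\prod_{i\in I}X_{ti}$, $X^t=\prod_{0\le k\le t}X_k$, $S^t=\prod_{0\le k\le t}S_k$. The sets of histories $H_t\subseteq X^t\times S^t$ are defined recursively, together with the following data for $t\ge 1$: - for each $i\in I$, a continuous (upper and lower hemicontinuous), nonempty compact valued action correspondence $A_{ti}$ from $H_{t-1}$ to $X_{ti}$; put $A_t=\prod_{i\in I}A_{ti}$; - Nature's move $f_{t0}:H_{t-1}\to\mathcal{M}(S_t)$, continuous, where $\mathcal{M}(\cdot)$ denotes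 the set of Borel probability measures with the topology of weak convergence; - $H_t=\mathrm{Gr}(A_t)\times S_t$, where $\mathrm{Gr}(A_t)$ is the graph of $A_t$ (coordinates are reordered so that $H_t\subseteq X^t\times S^t$). ''Without Nature'' means that Nature has no nontrivial move: $S_t$ is a singleton for all $t\ge1$ (so $f_{t0}$ is trivial). Perfect information: at each stage $t\ge1$ there is only one mover, who may depend on the history $h_{t-1}$. In a game without Nature this says that if $A_{ti}(h_{t-1})$ is not a single point for some $i\in I$ (player $i$ is the mover), then $A_{tj}(h_{t-1})$ is a single point for all $j\in I$, $j\ne i$. $H_\infty$ is the set of $(x,s)\in X^\infty\times S^\infty$ whose truncations satisfy $(x^t,s^t)\in H_t$ for all $t\ge0$, with the product topology. Each payoff function $u_i:H_\infty\to\mathbb{R}$ ($i\in I$) is bounded and continuous, and the game is continuous at infinity: $w^T\to0$ as $T\to\infty$, where $w^T=\sup|u_i(x,s)-u_i(\bar x,\bar s)|$ over all $i\in I$ and $(x,s),(\bar x,\bar s)\in H_\infty$ with $x^{T-1}=\bar x^{T-1}$, $s^{T-1}=\bar s^{T-1}$. The game is finite-horizon if there is a stage $T\ge1$ such that $A_{ti}$ is point-valued for every $i\in I$ and $t\ge T$. **Strategies.** A mixed strategy of player $i\in I$ is a sequence $f_i=\{f_{ti}\}_{t\ge1}$ of Borel measurable maps $f_{ti}:H_{t-1}\to\mathcal{M}(X_{ti})$ with $\operatorname{support}(f_{ti}(\cdot|h_{t-1}))\subseteq A_{ti}(h_{t-1})$ for all $h_{t-1}\in H_{t-1}$, where the support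 of a measure is the smallest closed set of measure $1$. It is a pure strategy if all $f_{ti}(\cdot|h_{t-1})$ are Dirac measures; a pure strategy $g_i$ is identified with the maps $g_{ti}:H_{t-1}\to X_{ti}$, $g_{ti}(h_{t-1})\in A_{ti}(h_{t-1})$. A strategy profile is $f=\{f_i\}_{i\in I}$. **Payoffs.** Given a profile $f$ and $h_t\in H_t$ ($t\ge0$), let $\tau_t=\delta_{h_t}$ and, for $t'\ge t$, $\tau_{t'+1}=\tau_{t'}\diamond(\otimes_{i\in I_0}f_{(t'+1)i})$, where $\lambda\diamond\nu(A\times B)=\int_A\nu(B|x)\,\lambda(dx)$. Let $\tau\in\mathcal{M}(H_\infty)$ be the unique measure with marginal $\tau_{t'}$ on $H_{t'}$ for all $t'\ge t$. Player $i$'s payoff from $f$ in the subgame beginning at $h_t$ is $\int_{H_\infty}u_i\,d\tau$. **Subgame-perfect equilibrium.** A profile $f$ such that for all $i\in I$, $t\ge0$ and $h_t\in H_t$, player $i$ cannot improve his payoff in the subgame beginning at $h_t$ by a unilateral change of his (mixed) strategy. *)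

(* Defs.v *)
From HB Require Import structures.
From mathcomp Require Import all_boot all_order all_algebra.
From mathcomp Require Import all_classical all_reals all_analysis.

Set Implicit Arguments.
Unset Strict Implicit.
Unset Printing Implicit Defensive.

Import Order.TTheory GRing.Theory Num.Theory.
Import numFieldNormedType.Exports.

Local Open Scope classical_set_scope.
Local Open Scope ring_scope.

(** Topological spaces are [ptopologicalType]s because the library's measurable
    types are pointed, hence nonempty. For the games below this only leaves out
    those with no history at all: action correspondences are nonempty valued
    and Nature's moves are probability measures. *)

Section topology.
Variable R : realType.

Definition metrizes (T : topologicalType) (d : T -> T -> R) :=
  [/\ forall x y, d x y = 0 <-> x = y,
      forall x y, d x y = d y x,
      forall x y z, d x z <= d x y + d y z
    & forall x (U : set T),
        nbhs x U <-> exists2 e, 0 < e & [set y | d x y < e] `<=` U].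

Definition metrizable (T : topologicalType) :=
  exists d : T -> T -> R, metrizes d.

Definition complete_distance (T : topologicalType) (d : T -> T -> R) :=
  forall a : nat -> T,
    (forall e, 0 < e ->
       exists N, forall p q, (N <= p)%N -> (N <= q)%N -> d (a p) (a q) < e) ->
    exists l : T, a @ \oo --> l.

Definition polish (T : topologicalType) :=
  (exists2 D : set T, countable D & dense D) /\
  (exists2 d : T -> T -> R, metrizes d & complete_distance d).

Definition upper_hemicontinuous (T U : topologicalType) (D : set T)
    (F : T -> set U) :=
  forall x, D x -> forall V, open V -> F x `<=` V ->
    \forall y \near within D (nbhs x), F y `<=` V.

Definition lower_hemicontinuous (T U : topologicalType) (D : set T)
    (F : T -> set U) :=
  forall x, D x -> forall V, open V -> F x `&` V !=set0 ->
    \forall y \near within D (nbhs x), F y `&` V !=set0.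

End topology.

Definition single_point (T : Type) (B : set T) := exists x, B = [set x].

(* These instances are the joins of existing topological and pointed ones. *)
HB.instance Definition _ (T U : ptopologicalType) :=
  Topological.on (T * U)%type.
HB.instance Definition _ (I : Type) (T : I -> ptopologicalType) :=
  Pointed.on (prod_topology T).

(** The Borel measurable space of a topological space. *)
Definition borel (T : ptopologicalType) := g_sigma_algebraType (@open T).

HB.instance Definition _ (T : ptopologicalType) :=
  Measurable.on (borel T).

(** Borel probability measures. A [probability] is a function on all sets,
    of which only the values on measurable sets are meaningful; equalities
    between measures are therefore stated on measurable sets below. *)
Definition prob (R : realType) (T : ptopologicalType) :=
  probability (borel T) R.

HB.instance Definition _ (R : realType) (T : ptopologicalType) :=
  Pointed.on (prob R T).

(** The topology of weak convergence: the coarsest one for which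
    [mu |-> \int[mu]_x g x] is continuous for all bounded continuous [g]. *)
Section weak_convergence.
Variables (R : realType) (T : ptopologicalType).

Definition weak_subbase_index : set ((T -> R) * set R) :=
  [set p | [/\ continuous p.1, bounded_fun p.1 & open p.2]].

Definition weak_subbase (p : (T -> R) * set R) : set (prob R T) :=
  [set mu : prob R T | p.2 (\int[mu]_x p.1 x)].

HB.instance Definition _ := @isSubBaseTopological.Build (prob R T)
  ((T -> R) * set R)%type weak_subbase_index weak_subbase.

End weak_convergence.

Definition measure_support (R : realType) (T : ptopologicalType)
    (mu : prob R T) : set T :=
  [set x | forall C : set T, closed C -> mu C = 1%E -> C x].

(** [start] is X_0, [chance t] is S_t, and [action t i] is X_(t+1)i. *)
Record spaces (n : nat) := Spaces {
  start : ptopologicalType ;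
  action : nat -> 'I_n -> ptopologicalType ;
  chance : nat -> ptopologicalType }.

Section histories.
Variables (n : nat) (G : spaces n).

(** The product of the players' action spaces at stage [t.+1]. *)
Definition joint_action (t : nat) : ptopologicalType :=
  prod_topology (fun i => action G t i).

(** X^t * S^t, with coordinates ordered as x_0, s_0, x_1, s_1, ... *)
Fixpoint prehistory (t : nat) : ptopologicalType :=
  if t is k.+1 then (prehistory k * (joint_action k * chance G k.+1))%type
  else (start G * chance G 0)%type.

Definition stage_action (t : nat) : ptopologicalType :=
  if t is k.+1 then joint_action k else start G.

Definition plays : ptopologicalType :=
  (prod_topology stage_action * prod_topology (chance G))%type.

Fixpoint trunc (z : plays) (t : nat) : prehistory t :=
  if t is k.+1 then (trunc z k, (z.1 k.+1, z.2 k.+1)) else (z.1 0, z.2 0).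

Variable A : forall t (i : 'I_n), prehistory t -> set (action G t i).

(** The set of histories H_t, as a subset of [prehistory t]. *)
Fixpoint history (t : nat) : set (prehistory t) :=
  if t is k.+1 then
    [set h : prehistory k.+1 | history h.1 /\ forall i, @A k i h.1 (h.2.1 i)]
  else setT.

Definition Hinf : set plays := [set z | forall t, history (trunc z t)].

(** The number w^(T+1) measuring the influence on payoffs of what happens after
    stage [T]. [sup] is 0 on the empty set. *)
Definition tail_oscillation (R : realType) (u : 'I_n -> plays -> R) (T : nat) :
    R :=
  sup [set r | exists i z z',
    [/\ Hinf z, Hinf z', trunc z T = trunc z' T & r = `|u i z - u i z'|]].

End histories.

Arguments history {n G} A t _.

(** [act t i] is the action correspondence A_(t+1)i and [nature t] is Nature's
    move f_(t+1)0, both with domain H_t. Functions of histories are total, but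
    only their restriction to [history t] is ever constrained or used; the same
    holds for payoff functions and [Hinf], and for the strategies below. *)
Record game (R : realType) (n : nat) := Game {
  sp :> spaces n ;
  act : forall t (i : 'I_n), prehistory sp t -> set (action sp t i) ;
  nature : forall t, prehistory sp t -> prob R (chance sp t.+1) ;
  utility : 'I_n -> plays sp -> R ;
  start_metrizable : metrizable R (start sp) ;
  start_compact : compact [set: start sp] ;
  action_polish : forall t i, polish R (action sp t i) ;
  chance_polish : forall t, polish R (chance sp t) ;
  act_uhc : forall t i, upper_hemicontinuous (history act t) (@act t i) ;
  act_lhc : forall t i, lower_hemicontinuous (history act t) (@act t i) ;
  act_nonempty : forall t i h, history act t h -> @act t i h !=set0 ;
  act_compact : forall t i h, history act t h -> compact (@act t i h) ;
  nature_continuous :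
    forall t, {within history act t, continuous (@nature t)} ;
  utility_bounded : forall i, [bounded utility i z | z in Hinf act] ;
  utility_continuous : forall i, {within Hinf act, continuous (utility i)} ;
  utility_continuous_at_infinity :
    tail_oscillation act utility @ \oo --> (0 : R) }.

Arguments act {R n} g t i h.
Arguments nature {R n} g t h.
Arguments utility {R n} g i z.

Section game_theory.
Variables (R : realType) (n : nat) (G : game R n).

Local Notation prehistory := (prehistory G).
Local Notation history := (history (act G)).
Local Notation Hinf := (Hinf (act G)).

Definition without_nature := forall t, single_point [set: chance G t.+1].

(** Perfect information for a game without Nature (where Nature is never the
    mover). *)
Definition perfect_information :=
  forall t (h : prehistory t), history t h ->
    forall i, ~ single_point (act G t i h) ->
      forall j, j != i -> single_point (act G t j h).

Definition finite_horizon :=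
  exists T, forall t, (T <= t)%N -> forall (h : prehistory t), history t h ->
    forall i, single_point (act G t i h).

Definition no_indifference :=
  forall z z', Hinf z -> Hinf z' ->
    (exists i, utility G i z = utility G i z') ->
    forall j, utility G j z = utility G j z'.

(** The component at [t] of a strategy of player [i] is f_(t+1)i. *)
Definition strategy_map (i : 'I_n) :=
  forall t, prehistory t -> prob R (action G t i).

(** Measurability is with respect to the Borel sigma-algebra of the topology of
    weak convergence. *)
Definition is_strategy (i : 'I_n) (fi : strategy_map i) :=
  forall t,
    measurable_fun (history t : set (borel (prehistory t)))
      (fi t : borel (prehistory t) -> borel (prob R (action G t i))) /\
    forall h, history t h -> measure_support (fi t h) `<=` act G t i h.

Definition profile := forall i, strategy_map i.

Definition is_profile (f : profile) := forall i, is_strategy (f i).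

Definition dirac_prob (T : ptopologicalType) (x : T) : prob R T :=
  @dirac _ (borel T) x R.

Definition pure_map (i : 'I_n) := forall t, prehistory t -> action G t i.

Definition pure_profile := forall i, pure_map i.

(** The profile of Dirac measures identified with [g]; [g] is a pure-strategy
    profile when it is a profile of strategies. *)
Definition mixed_of_pure (g : pure_profile) : profile :=
  fun i t h => dirac_prob (g i t h).

(** [pi] is the product of the measures [mu i] and of [nu]. *)
Definition is_product_measure (t : nat) (mu : forall i, prob R (action G t i))
    (nu : prob R (chance G t.+1))
    (pi : prob R (joint_action G t * chance G t.+1)%type) :=
  forall (B : forall i, set (borel (action G t i)))
      (C : set (borel (chance G t.+1))),
    (forall i, measurable (B i)) -> measurable C ->
    pi ([set x : joint_action G t | forall i, B i (x i)] `*` C) =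
    ((\prod_(i < n) mu i (B i)) * nu C)%E.

(** [pi] is the composition [la <> nu] of a measure [la] living on [D] and
    a transition probability [nu] with domain [D]. *)
Definition is_composition (T U : ptopologicalType) (D : set T) (la : prob R T)
    (nu : T -> prob R U) (pi : prob R (T * U)%type) :=
  forall (A : set (borel T)) (B : set (borel U)),
    measurable A -> measurable B ->
    pi (A `*` B) = (\int[la]_(x in A `&` D) nu x B)%E.

(** [tau] is the law of the play induced by [f] in the subgame beginning at
    [h]; [taus k] is its marginal on H_k and [nus k] the joint law of the moves
    of stage [k.+1]. *)
Definition is_outcome_law (f : profile) (t : nat) (h : prehistory t)
    (tau : prob R (plays G)) :=
  tau Hinf = 1%E /\
  exists (taus : forall k, prob R (prehistory k))
    (nus : forall k, prehistory k ->
             prob R (joint_action G k * chance G k.+1)%type),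
    [/\ forall B : set (borel (prehistory t)), measurable B ->
          taus t B = dirac_prob h B,
        forall k (h' : prehistory k), (t <= k)%N -> history k h' ->
          is_product_measure (fun i => f i k h') (nature G k h') (nus k h'),
        forall k, (t <= k)%N ->
          is_composition (history k) (taus k) (nus k) (taus k.+1)
      & forall k (B : set (borel (prehistory k))), (t <= k)%N -> measurable B ->
          tau ((fun z => trunc z k) @^-1` B) = taus k B].

(** The measure is unique on measurable sets, so [payoff] does not depend on
    the one that is chosen. *)
Definition outcome_law (f : profile) (t : nat) (h : prehistory t) :
    prob R (plays G) :=
  get (is_outcome_law f h).

Definition payoff (f : profile) (i : 'I_n) (t : nat) (h : prehistory t) : R :=
  \int[outcome_law f h]_(z in Hinf) utility G i z.

Definition subgame_perfect_equilibrium (f : profile) :=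
  is_profile f /\
  forall i t (h : prehistory t), history t h ->
    forall fi' : strategy_map i, is_strategy fi' ->
      payoff (dfwith f i fi') i h <= payoff f i h.

Definition no_mixing (f : profile) :=
  forall g : pure_profile, is_profile (mixed_of_pure g) ->
    (forall t i (h : prehistory t), history t h ->
       measure_support (f i t h) (g i t h)) ->
    subgame_perfect_equilibrium (mixed_of_pure g).

End game_theory.

(* Main.v *)
Require Import Defs.
From HB Require Import structures.
From mathcomp Require Import all_boot all_order all_algebra.
From mathcomp Require Import finmap.
From mathcomp Require Import all_classical all_reals all_analysis.
From mathcomp Require Import measurable_realfun.

(** Let [V h] be the vector of payoffs of the equilibrium [f] in the subgame
    beginning at [h]. Going backwards from the horizon, [V] is continuous, is the
    payoff vector of some play, and at every history the whole support of the
    mover's mixed move maximizes his component of [V]. Indeed, one-shot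
    deviations show that he maximizes it with probability one; since [V] is
    continuous at the next stage, the set of maximizers is closed and contains
    the support; no indifference makes all of [V] constant on it. At the current
    stage [V] is continuous because a limit, along an ultrafilter, of moves in
    the supports is a maximizer at the limit history. Hence along any profile
    [g] selected from the supports [V] is constant, while along a deviation of
    player [i] from [g] his component of [V] cannot increase.

    No integral over intermediate histories is ever computed: a closed set of
    histories containing all moves of full measure is almost surely entered,
    because its complement is a countable union of null rectangles. Integrals
    are only needed to construct the outcome laws, which [payoff] presupposes. *)

Set Implicit Arguments.
Unset Strict Implicit.
Unset Printing Implicit Defensive.

Import Order.TTheory GRing.Theory Num.Theory.
Import numFieldNormedType.Exports.

Local Open Scope classical_set_scope.
Local Open Scope ring_scope.

(** * Ultrafilters, finite products and countable bases *)

Section ultrafilters.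

(** The obstacle is that [f] depends on the history only measurably, so continuity of [V] cannot be
    inherited from the strategies: near a given history the supports, and even the identity of the
    mover, may change abruptly. In the limit the supports are therefore replaced by a condition that
    mentions neither: no single player gains by changing his own action. Upper hemicontinuity
    supplies the limit move, and lower hemicontinuity lets every deviation at the limit history be
    approximated by deviations nearby. Such a condition fixes only the mover's component of [V]. No
    indifference fixes the other components, but it speaks of plays rather than of expected payoffs,
    which is why the induction also carries the fact that each value of [V] is attained by a play.
    Ultrafilters take the place of sequences because in a compact set they converge without
    extraction of subsequences. *)

Lemma cvg_ultra (T : Type) (U : topologicalType) (F : set_system T)
    (phi : T -> U) (y : U) : Filter F ->
  (forall G : set_system T, UltraFilter G -> F `<=` G -> phi @ G --> y) ->
  phi @ F --> y.
Proof.
move=> FF h V Vy; rewrite /= nbhs_filterE.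
apply: contrapT; rewrite -[_ V]/(F (phi @^-1` V)) => nV.
(* If [V] fails, [F] stays proper after the complement of the preimage of [V] is adjoined; an
   ultrafilter refining the result contradicts the hypothesis. *)
pose F' := filter_from F (fun B => B `&` ~` (phi @^-1` V)).
have PF' : ProperFilter F'.
  apply: filter_from_proper; first apply: filter_from_filter.
  - by exists setT; exact: filterT.
  - move=> A B FA FB; exists (A `&` B); first exact: filterI.
    by move=> x [[Ax Bx] nx].
  - move=> B FB; apply: contrapT => Be; apply: nV.
    apply: (filterS (P := B)) FB => x Bx.
    by apply: contrapT => nx; apply: Be; exists x.
have [G [GU F'G]] := ultraFilterLemma PF'.
have FG : F `<=` G by move=> B FB; apply: F'G; exists B => // x [].
have GnV : G (~` (phi @^-1` V)).
  by apply: F'G; exists setT; [exact: filterT|move=> x []].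
have GV : G (phi @^-1` V) := h G GU FG V Vy.
by have /filter_ex [x []] : G (~` (phi @^-1` V) `&` phi @^-1` V) by exact: filterI.
Qed.

Lemma closed_ultra (T : topologicalType) (C : set T) :
  (forall (F : set_system T) x, UltraFilter F -> F C -> F --> x -> C x) ->
  closed C.
Proof.
move=> h x; rewrite closureEcvg => -[F FF [Fx CF]].
have [G [GU FG]] := ultraFilterLemma FF.
apply: (h G x GU); first exact/FG/CF.
exact: (cvg_trans FG).
Qed.

Lemma within_continuous_cvg (Z : Type) (T U : topologicalType) (H : set T)
    (phi : T -> U) (F : set_system Z) (p : Z -> T) (x : T) : Filter F ->
  {within H, continuous phi} -> p @ F --> x -> H x -> F (p @^-1` H) ->
  (phi \o p) @ F --> phi x.
Proof.
move=> FF /subspace_continuousP cphi Fx Hx FH V Vphi.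
have /Fx := cphi x Hx V Vphi; rewrite /= !nbhs_filterE /= => FB.
by apply: filterS (filterI FB FH) => z [/= + ?]; exact.
Qed.

Lemma within_continuous_ultra (T U : topologicalType) (H : set T)
    (phi : T -> U) :
  (forall x (F : set_system T), H x -> UltraFilter F -> F H -> F --> x ->
    phi @ F --> phi x) -> {within H, continuous phi}.
Proof.
move=> h; apply/subspace_continuousP => x Hx; apply: cvg_ultra => G GU wG.
apply: h => //; first by apply: wG; exact: withinT.
by apply: cvg_trans wG (cvg_within H).
Qed.

Lemma closed_within_preimage (T U : topologicalType) (H : set T)
    (phi : T -> U) (D : set U) :
  closed H -> {within H, continuous phi} -> closed D ->
  closed (H `&` phi @^-1` D).
Proof.
move=> cH cphi cD; apply: closed_ultra => F x FU FHD Fx.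
have FH : F H by apply: filterS FHD => ? [].
have Hx : H x by exact: (@closed_cvg _ _ F _ id H cH FH x Fx).
split => //; apply: (@closed_cvg _ _ F _ phi D cD).
  by apply: filterS FHD => ? [].
by apply: (within_continuous_cvg (p := id)).
Qed.

(* Upper hemicontinuity is used only through this lemma. *)
Lemma uhc_ultra_cvg (Z : Type) (T : topologicalType) (U : ptopologicalType)
    (D : set T) (A : T -> set U) (F : set_system Z) (p : Z -> T) (q : Z -> U)
    (x : T) :
  UltraFilter F -> upper_hemicontinuous D A -> compact (A x) -> D x ->
  p @ F --> x -> F [set z | D (p z) /\ A (p z) (q z)] ->
  exists2 y, A x y & q @ F --> y.
Proof.
move=> FU uhc cA Dx Fx FA; apply: contrapT => nlim.
(* If [q] has no limit in [A x], each [y] in [A x] has an open neighbourhood [V y] that [q] avoids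
   along [F], since an ultrafilter contains a set or its complement. By compactness finitely many
   [V y] cover [A x], and upper hemicontinuity then forces [q] into their union. Outside [A x] the
   value [setT] is a dummy. *)
have /choice[V Vh] : forall y, exists V : set U,
    open V /\ (A x y -> V y /\ F (q @^-1` ~` V)).
  move=> y; have [Ay|] := pselect (A x y); last first.
    by exists setT; split=> //; exact: openT.
  have : ~ q @ F --> y by move=> ?; apply: nlim; exists y.
  move=> /existsNP [W] /not_implyP [] /=.
  rewrite nbhsE => -[V [oV Vy] VW] nFW; exists V; split => // _; split => //.
  have [FV|//] := in_ultra_setVsetC (q @^-1` V) FU.
  by case: nFW; rewrite nbhs_filterE; apply: filterS FV => z; exact: VW.
have := cA; rewrite compact_cover => /(_ U (A x) V) [|y Ay|D0 D0A cov].
- by move=> y _; have [] := Vh y.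
- by exists y => //; have [_ /(_ Ay)[]] := Vh y.
have /Fx := uhc x Dx (\bigcup_(y in [set` D0]) V y)
  (bigcup_open (fun y _ => proj1 (Vh y))) cov.
rewrite /= !nbhs_filterE /= => FV.
have Fn : F (\bigcap_(y in [set` D0]) (q @^-1` ~` V y)).
  apply: filter_bigI => y yD.
  by have := D0A _ yD; rewrite inE => Ay; have [_ /(_ Ay)[]] := Vh y.
have FN : F ([set z | D (p z) -> A (p z) `<=` \bigcup_(y in [set` D0]) V y] `&`
    ((\bigcap_(y in [set` D0]) (q @^-1` (~` V y))) `&`
    [set z | D (p z) /\ A (p z) (q z)])).
  by apply: filterI => //; apply: filterI.
have [z [zA [zN [Dz Az]]]] := @filter_ex _ F ultra_proper _ FN.
by have [y yD Vyz] := zA Dz _ Az; exact: (zN y yD).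
Qed.

End ultrafilters.

Section product_topology.

Lemma cvg_prod_topology (I : eqType) (K : I -> topologicalType)
    (Z : Type) (F : set_system Z) (p : Z -> prod_topology K)
    (x : prod_topology K) : Filter F ->
  (forall i, (fun z => p z i) @ F --> x i) -> p @ F --> x.
Proof.
move=> FF h; apply/cvg_sup => i V [B [[W oW <-] Wx] BV].
rewrite /= nbhs_filterE; apply: (filterS (P := p @^-1` (@proj I K i @^-1` W))).
  by move=> z Wz; exact: BV.
exact: (h i W (open_nbhs_nbhs (conj oW Wx))).
Qed.

(** The filter generated by the open boxes around [x] converges to [x] in each coordinate, hence in
    the product topology; so every neighbourhood belongs to it. *)
Lemma prod_topology_box (I : finType) (K : I -> topologicalType)
    (x : prod_topology K) (A : set (prod_topology K)) : nbhs x A ->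
  exists2 U : forall i, set (K i),
    forall i, open (U i) /\ U i (x i) & [set y | forall i, U i (y i)] `<=` A.
Proof.
pose Fx := filter_from
  [set U : forall i, set (K i) | forall i, open (U i) /\ U i (x i)]
  (fun U => [set y : prod_topology K | forall i, U i (y i)]).
have FF : Filter Fx.
  apply: filter_from_filter.
    by exists (fun=> setT) => i; split=> //; exact: openT.
  move=> U V hU hV; exists (fun i => U i `&` V i).
    move=> i; have [oU Ux] := hU i; have [oV Vx] := hV i.
    by split=> //; exact: openI.
  by move=> y UV; split=> i; have [] := UV i.
have /(_ A) : id @ Fx --> x.
  apply: cvg_prod_topology => i W; rewrite nbhsE => -[V [oV Vx] VW].
  exists (dfwith (fun j => [set: K j]) i V).
    by move=> j; case: dfwithP => [|k _]; split=> //; exact: openT.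
  by move=> y /(_ i); rewrite dfwithin => /VW.
by move=> h /h [U hU UA]; exists U.
Qed.

Lemma open_box (I : finType) (K : I -> topologicalType)
    (U : forall i, set (K i)) : (forall i, open (U i)) ->
  open [set y : prod_topology K | forall i, U i (y i)].
Proof.
move=> oU; rewrite openE => y Uy.
apply: (filter_forall (F := nbhs y)
  (f := fun i (y : prod_topology K) => U i (y i))) => i.
by apply: (@proj_continuous _ K i y); apply: open_nbhs_nbhs; split.
Qed.

Lemma closed_box (I : eqType) (K : I -> topologicalType)
    (U : forall i, set (K i)) : (forall i, closed (U i)) ->
  closed [set y : prod_topology K | forall i, U i (y i)].
Proof.
move=> cU; apply: closed_ultra => F x FU FC Fx i.
have FCi : F [set y | U i (y i)] by apply: filterS FC => y; exact.
have Fxi : (fun y : prod_topology K => y i) @ F --> x i.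
  by move=> V /(@proj_continuous _ K i x)/Fx.
exact: (@closed_cvg _ _ F ultra_proper (fun y => y i) (U i) (cU i) FCi _ Fxi).
Qed.

(** Joint continuity is what is used: deviations are followed while the actions of the other players
    vary as well. *)
Lemma dfwith2_continuous (I : eqType) (K : I -> topologicalType) (i : I) :
  continuous (fun b : prod_topology K * K i =>
    dfwith b.1 i b.2 : prod_topology K).
Proof.
move=> [z y]; apply: cvg_prod_topology => j; have [<-|ij] := eqVneq i j.
  have -> : (fun b : prod_topology K * K i => dfwith b.1 i b.2 i) = snd.
    by apply/funext => b; rewrite dfwithin.
  by rewrite dfwithin; exact: cvg_snd.
have -> : (fun b : prod_topology K * K i => dfwith b.1 i b.2 j) =
    @proj _ K j \o fst.
  by apply/funext => b; rewrite dfwithout.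
rewrite dfwithout //=.
apply: (@cvg_comp _ _ _ fst (@proj _ K j) _ (nbhs z)); first exact: cvg_fst.
exact: proj_continuous.
Qed.

End product_topology.

Section countable_base.

(** Enumerated by [nat], so that countable subadditivity applies directly; repetitions and empty
    members are allowed. *)
Definition countable_base (T : topologicalType) (W : nat -> set T) :=
  (forall k, open (W k)) /\
  (forall x A, nbhs x A -> exists2 k, W k x & W k `<=` A).

Lemma open_setX (T U : topologicalType) (A : set T) (B : set U) :
  open A -> open B -> open (A `*` B).
Proof.
rewrite !openE => oA oB [x y] [/= /oA Ax /oB By].
by exists (A, B).
Qed.

Lemma prod_countable_base (T U : topologicalType) (V : nat -> set T)
    (W : nat -> set U) :
  countable_base V -> countable_base W ->
  exists B, @countable_base (T * U)%type B.
Proof.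
move=> [oV bV] [oW bW].
exists (fun k => if choice.unpickle k is Some p then V p.1 `*` W p.2 else set0).
split=> [k|x A].
  by case: choice.unpickle => [p|]; [exact: open_setX|exact: open0].
case=> -[P Q] /= [/bV[i Vi ViP] /bW[j Wj WjQ]] PQA.
exists (choice.pickle (i, j)); rewrite choice.pickleK //= => y [/ViP ? /WjQ ?].
exact: PQA.
Qed.

Lemma box_countable_base (I : finType) (K : I -> topologicalType) :
  (forall i, exists W, @countable_base (K i) W) ->
  exists B, @countable_base (prod_topology K) B.
Proof.
move=> hK; pose W i := projT1 (cid (hK i)).
have hW i : countable_base (W i) by exact: projT2 (cid (hK i)).
exists (fun k => if choice.unpickle k is Some phi then
  [set y : prod_topology K | forall i, W i ((phi : {ffun I -> nat}) i) (y i)]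
  else set0).
split=> [k|x A].
  case: choice.unpickle => [phi|]; last exact: open0.
  by apply: (@open_box I K (fun i => W i (phi i))) => i; have [] := hW i.
move=> /prod_topology_box[U hU UA].
have /choice[phi hphi] i : exists k, W i k (x i) /\ W i k `<=` U i.
  have [oU Ux] := hU i; have [_ bW] := hW i.
  by have [k ? ?] := bW _ _ (open_nbhs_nbhs (conj oU Ux)); exists k.
exists (choice.pickle [ffun i => phi i]); rewrite choice.pickleK /=.
  by move=> i; rewrite ffunE; have [] := hphi i.
move=> y hy; apply: UA => i; have := hy i; rewrite ffunE.
by have [_ h] := hphi i => /h.
Qed.

End countable_base.

Section metrizable.
Variables (R : realType) (T : topologicalType) (d : T -> T -> R).
Hypothesis md : metrizes d.

Lemma metrizes_ge0 x y : 0 <= d x y.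
Proof.
have [d0 dC dD _] := md; have := dD x y x.
by rewrite (dC y x) (_ : d x x = 0) ?d0 // -mulr2n pmulrn_lge0.
Qed.

Lemma metrizes_ball x e : 0 < e -> nbhs x [set y | d x y < e].
Proof. by have [_ _ _ ->] := md; exists e. Qed.

Lemma metrizes_hausdorff : hausdorff_space T.
Proof.
have [d0 dC dD dN] := md => x y cxy; apply/d0/eqP.
rewrite eq_le metrizes_ge0 andbT leNgt; apply/negP => dxy.
have e0 : 0 < d x y / 2 by rewrite divr_gt0.
have [z [/= xz yz]] := cxy _ _ (metrizes_ball x e0) (metrizes_ball y e0).
have := dD x z y; rewrite leNgt (dC z y).
by rewrite (lt_le_trans (ltrD xz yz)) // -splitr.
Qed.

Lemma separable_countable_base (D : set T) : countable D -> dense D ->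
  exists W, @countable_base T W.
Proof.
have [d0 dC dD dN] := md => cD dDn.
have op x e : open [set y | d x y < e].
  rewrite openE => y /= xy; rewrite /interior dN; exists (e - d x y).
    by rewrite subr_gt0.
  move=> z /=; rewrite ltrBrDl; exact: le_lt_trans.
have [D0|[e]] := pfcard_geP cD.
  exists (fun=> set0); split=> [_|x A xA]; first exact: open0.
  have [||x0] := dDn setT; [by exists x|exact: openT|].
  by rewrite D0 => -[].
exists (fun k => if choice.unpickle k is Some p then
  [set y | d (e p.1) y < p.2.+1%:R^-1] else set0).
split=> [k|x A]; first by case: choice.unpickle => [p|]; [exact: op|exact: open0].
rewrite dN => -[r r0 rA].
have r2 : 0 < r / 2 by rewrite divr_gt0.
have [m] := ltr_add_invr r2; rewrite add0r => mr.
have [||z [/= zx Dz]] := dDn [set y | d x y < m.+1%:R^-1].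
- by exists x; rewrite /= (_ : d x x = 0) ?d0 // invr_gt0.
- exact: op.
have [n _ en] := @surj _ _ _ _ e z Dz.
exists (choice.pickle (n, m)); rewrite choice.pickleK /= en.
  by rewrite dC.
move=> y /= zy; apply: rA => /=; rewrite (le_lt_trans (dD x z y))//.
by rewrite [r]splitr ltrD // (lt_trans _ mr).
Qed.

End metrizable.

(** * Borel probability measures *)

Section almost_sure.
Context d (T : measurableType d) (R : realType) (P : probability T R).
Local Open Scope ereal_scope.

Lemma probability_eq1S (A B : set T) : measurable A -> measurable B ->
  A `<=` B -> P A = 1 -> P B = 1.
Proof.
move=> mA mB AB PA; apply/eqP; rewrite eq_le probability_le1 //= -PA.
by rewrite le_measure // inE.
Qed.

Lemma probability_eq1C (A : set T) : measurable A -> P A = 1 <-> P (~` A) = 0.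
Proof.
move=> mA; split=> [PA|P0]; first by rewrite probability_setC // PA subee.
by rewrite -(setCK A) probability_setC ?P0 ?sube0 //; exact: measurableC.
Qed.

Lemma probability_eq1I (A B : set T) : measurable A -> measurable B ->
  P A = 1 -> P B = 1 -> P (A `&` B) = 1.
Proof.
move=> mA mB /(probability_eq1C mA) A0 /(probability_eq1C mB) B0.
apply/probability_eq1C; first exact: measurableI.
rewrite setCI; apply: null_set_setU => //; exact: measurableC.
Qed.

Lemma probability_eq1_nonempty (A : set T) : P A = 1 -> A !=set0.
Proof.
move=> PA; apply/set0P/eqP => A0; move: PA; rewrite A0 measure0.
by move/esym/eqP; rewrite onee_eq0.
Qed.

End almost_sure.

Section borel_lemmas.

Lemma borel_open (T : ptopologicalType) (U : set T) : open U ->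
  measurable (U : set (borel T)).
Proof. by move=> oU; exact: sub_sigma_algebra. Qed.

Lemma borel_closed (T : ptopologicalType) (C : set T) : closed C ->
  measurable (C : set (borel T)).
Proof.
move=> cC; rewrite -(setCK C); apply: measurableC; apply: borel_open.
by rewrite openC.
Qed.

Lemma borel_measurable_fun d (aT : measurableType d) (T : ptopologicalType)
    (D : set aT) (f : aT -> borel T) :
  (forall U : set T, open U -> measurable (D `&` f @^-1` U)) ->
  measurable_fun D f.
Proof.
move=> h; apply: (@measurability _ _ aT (borel T) D f (@open T)) => //.
by move=> _ [U oU <-]; exact: h.
Qed.

Lemma borel_within_continuous (T U : ptopologicalType) (H : set T)
    (phi : T -> U) : closed H -> {within H, continuous phi} ->
  measurable_fun (H : set (borel T)) (phi : borel T -> borel U).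
Proof.
move=> cH cphi; apply: borel_measurable_fun => V oV.
have -> : H `&` phi @^-1` V = H `\` (H `&` phi @^-1` (~` V)).
  apply/seteqP; split=> x /=; first by move=> [Hx Vx]; split => // -[].
  by move=> [Hx nV]; split => //; apply: contrapT => ?; exact: nV.
apply: measurableD; apply: borel_closed => //.
by apply: closed_within_preimage => //; exact: open_closedC.
Qed.

Lemma borel_continuous (T U : ptopologicalType) (phi : T -> U) :
  continuous phi ->
  measurable_fun [set: borel T] (phi : borel T -> borel U).
Proof.
by move=> ?; apply: borel_within_continuous => //; exact: continuous_subspaceT.
Qed.

Lemma borel_within_continuous_real (R : realType) (T : ptopologicalType)
    (H : set T) (phi : T -> R) : closed H -> {within H, continuous phi} ->
  measurable_fun (H : set (borel T)) (phi : borel T -> R).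
Proof.
move=> cH cphi.
have := @borel_within_continuous T R H phi cH cphi.
move=> h mH; apply: (measurability _ (RGenOInfty.measurableE R)) => //.
move=> _ [_ [x ->] <-]; apply: h => //; apply: borel_open.
exact: interval_open.
Qed.

(** For each basic [W k] there is a largest open [V k] whose rectangle with [W k] lies in [O], and
    these rectangles exhaust [O]. A countable base of one factor thus suffices. *)
Lemma open_rectangles (T U : ptopologicalType) (W : nat -> set U)
    (O : set (T * U)) : countable_base W -> open O ->
  exists2 V : nat -> set T, (forall k, open (V k)) &
    O = \bigcup_k (V k `*` W k).
Proof.
move=> [oW bW] oO.
exists (fun k => [set x | forall y, W k y -> O (x, y)]°).
  by move=> k; exact: open_interior.
apply/seteqP; split=> [[x y] Oxy|[x y] [k _] [/= xk Wy]]; last first.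
  exact: (interior_subset xk).
have := oO; rewrite openE => /(_ _ Oxy) [[A B] /= [xA yB] ABO].
have [k Wy WB] := bW _ _ yB; exists k => //; split => //=.
by apply: filterS xA => x' Ax' y' Wy'; apply: ABO; split => //=; exact: WB.
Qed.

(** Passage from the product of two Borel sigma-algebras, where kernels are composed, to the Borel
    sigma-algebra of the product space, where laws of histories live. *)
Lemma measurable_prod_borel (T U : ptopologicalType) (W : nat -> set U) :
  countable_base W ->
  measurable_fun [set: (borel T * borel U)%type]
    (id : (borel T * borel U)%type -> borel (T * U)%type).
Proof.
move=> bW; apply: borel_measurable_fun => O /(open_rectangles bW)[V oV ->].
rewrite setTI preimage_id; apply: bigcupT_measurable => k.
by apply: measurableX; apply: borel_open => //; have [] := bW.
Qed.

Lemma composition_eq1 (R : realType) (T U : ptopologicalType) (W : nat -> set U)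
    (D : set T) (la : prob R T) (nu : T -> prob R U)
    (pi : prob R (T * U)%type) (C : set (T * U)) :
  countable_base W -> is_composition D la nu pi -> closed C ->
  (forall x, D x -> nu x [set y | C (x, y)] = 1%E) -> pi C = 1%E.
Proof.
move=> bW comp cC nuC; apply/probability_eq1C; first exact: borel_closed.
have [V oV CV] := open_rectangles bW (closed_openC cC).
rewrite CV; have oW := proj1 bW.
have mVW k : measurable (V k `*` W k : set (borel (T * U)%type)).
  by apply: borel_open; exact: open_setX.
apply/eqP; rewrite eq_le measure_ge0 andbT.
apply: le_trans (@measure_sigma_subadditive _ _ _ pi _
  (fun k => V k `*` W k) mVW (bigcupT_measurable _ mVW) _) _ => //.
rewrite eseries0 // => k _ _.
have : pi (V k `*` W k) = 0%E; last by [].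
rewrite comp; try exact: borel_open.
(* The integrand vanishes on the whole domain: for [x] in [V k] the set [W k] misses the section of
   [C] over [x], which has full measure. *)
apply: integral0_eq => x [Vx Dx].
have cCx : closed [set y | C (x, y)].
  have /continuous_closedP : continuous (fun y : U => (x, y)).
    by move=> y; apply: cvg_pair; [exact: cvg_cst|exact: cvg_id].
  exact.
have := nuC x Dx => /probability_eq1C -/(_ (borel_closed cCx)) n0.
apply/eqP; rewrite eq_le measure_ge0 andbT -n0; apply: le_measure.
- by rewrite inE; exact: borel_open.
- by rewrite inE; apply: measurableC; exact: borel_closed.
move=> y Wy /= Cxy.
by have : (~` C) (x, y) by rewrite CV; exists k.
Qed.

Lemma support_closed (R : realType) (T : ptopologicalType) (mu : prob R T) :
  closed (measure_support mu).
Proof.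
rewrite (_ : measure_support mu =
  \bigcap_(C in [set C | closed C /\ mu C = 1%E]) C).
  by apply: closed_bigI => C [].
by apply/seteqP; split=> [x h C []|x h C cC muC]; [exact: h|exact: h].
Qed.

(** The complement of the support is the union of the null sets among the basic open sets, and there
    are only countably many of them. *)
Lemma support_eq1 (R : realType) (T : ptopologicalType) (W : nat -> set T)
    (mu : prob R T) : countable_base W -> mu (measure_support mu) = 1%E.
Proof.
move=> [oW bW].
apply/probability_eq1C; first by apply: borel_closed; exact: support_closed.
pose B k := if mu (W k) == 0%E then W k else set0.
have mB k : measurable (B k : set (borel T)).
  by rewrite /B; case: ifP => _ //; exact: borel_open.
have -> : ~` measure_support mu = \bigcup_k B k.
  apply/seteqP; split=> [x|x [k _]].
    move=> /existsNP[C /not_implyP[cC /not_implyP[muC nC]]].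
    have [|k Wx WC] := bW x (~` C).
      by apply: open_nbhs_nbhs; split => //; exact: closed_openC.
    exists k => //; rewrite /B ifT //; apply/eqP/eqP.
    rewrite eq_le measure_ge0 andbT.
    move/(probability_eq1C mu (borel_closed cC)): muC => <-.
    apply: le_measure => //; rewrite inE; first exact: borel_open.
    by apply: measurableC; exact: borel_closed.
  rewrite /B; case: ifP => // /eqP W0 Wx sx.
  apply: (sx (~` W k)) => //; first exact: open_closedC.
  by rewrite probability_setC ?W0 ?sube0 //; exact: borel_open.
apply/eqP; rewrite eq_le measure_ge0 andbT.
apply: le_trans (@measure_sigma_subadditive _ _ _ mu _ B mB
  (bigcupT_measurable _ mB) _) _ => //.
rewrite eseries0 // => k _ _; rewrite /B.
by case: ifP => [/eqP//|_]; rewrite measure0.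
Qed.

End borel_lemmas.

(** * Weak measurability and kernels *)

Section weak_measurability.
Variables (R : realType) (T : ptopologicalType).

Lemma open_weak_subbase (g : T -> R) (V : set R) :
  continuous g -> bounded_fun g -> open V ->
  open [set mu : prob R T | V (\int[mu]_x g x)].
Proof.
move=> cg bg oV; exists [set @weak_subbase R T (g, V)]; last first.
  by apply/seteqP; split=> [mu [_ ->]//|mu Vmu]; exists (@weak_subbase R T (g, V)).
move=> _ ->; exists [fset (g, V)]%fset.
  by move=> p; rewrite !inE => /eqP ->.
apply/seteqP; split=> [mu /(_ (g, V))|mu Vmu p /=].
  by apply; rewrite /= inE.
by rewrite inE => /eqP ->.
Qed.

Lemma measurable_weak_integral d (X : measurableType d) (H : set X)
    (f : X -> prob R T) (g : T -> R) :
  measurable_fun H (f : X -> borel (prob R T)) ->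
  continuous g -> bounded_fun g ->
  measurable_fun H (fun x => \int[f x]_y g y).
Proof.
move=> mf cg bg mH; apply: (measurability _ (RGenOInfty.measurableE R)) => //.
move=> _ [_ [r ->] <-].
apply: (mf mH [set mu : prob R T | `]r, +oo[%classic (\int[mu]_x g x)]).
by apply: borel_open; apply: open_weak_subbase => //; exact: interval_open.
Qed.

Variable dist : T -> T -> R.
Hypothesis md : metrizes dist.

Definition distance_to (C : set T) (x : T) : R := inf [set dist x c | c in C].

Lemma distance_to_has_inf (C : set T) x : C !=set0 ->
  has_inf [set dist x c | c in C].
Proof.
move=> [c Cc]; split; first by exists (dist x c), c.
by exists 0 => _ [y _ <-]; exact: metrizes_ge0 md _ _.
Qed.

Lemma distance_to_lip (C : set T) x y : C !=set0 ->
  distance_to C x <= dist x y + distance_to C y.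
Proof.
have [d0 dC dD dN] := md => C0; rewrite -lerBlDl.
apply: lb_le_inf; first by have [] := distance_to_has_inf y C0.
move=> _ [c Cc <-]; rewrite lerBlDl; apply: le_trans (dD x y c).
apply: ge_inf; last by exists c.
by have [] := distance_to_has_inf x C0.
Qed.

Lemma continuous_distance_to (C : set T) : C !=set0 ->
  continuous (distance_to C).
Proof.
have [d0 dC dD dN] := md => C0 x; apply/cvgrPdist_lt => e e0.
have := metrizes_ball md x e0; apply: filterS => y /= xy.
rewrite ltr_norml; apply/andP; split.
  rewrite ltrNl opprB ltrBlDr (le_lt_trans (distance_to_lip y x C0)) //.
  by rewrite ltrD2r dC.
by rewrite ltrBlDr (le_lt_trans (distance_to_lip x y C0)) // ltrD2r.
Qed.

Lemma distance_to_gt0 (C : set T) x : C !=set0 -> closed C -> ~ C x ->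
  0 < distance_to C x.
Proof.
have [d0 dC dD dN] := md => C0 cC nCx.
have : nbhs x (~` C).
  by apply: open_nbhs_nbhs; split => //; exact: closed_openC.
rewrite dN => -[e e0 eC]; apply: (lt_le_trans e0).
apply: lb_le_inf; first by have [] := distance_to_has_inf x C0.
by move=> _ [c Cc <-]; rewrite leNgt; apply/negP => /eC; exact.
Qed.

Lemma distance_to_ge0 (C : set T) x : C !=set0 -> 0 <= distance_to C x.
Proof.
move=> C0; apply: lb_le_inf; first by have [] := distance_to_has_inf x C0.
by move=> _ [c Cc <-]; exact: metrizes_ge0 md _ _.
Qed.

Lemma distance_to_eq0 (C : set T) x : C x -> distance_to C x = 0.
Proof.
have [d0 dC dD dN] := md => Cx; have C0 : C !=set0 by exists x.
apply/eqP; rewrite eq_le distance_to_ge0 // andbT.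
rewrite -(_ : dist x x = 0) ?d0 //; apply: ge_inf; last by exists x.
by have [] := distance_to_has_inf x C0.
Qed.

(** Bounded continuous test functions that tend pointwise to the indicator of a nonempty closed [C]
    as [m] grows; they lead from integrals to measures of closed sets. *)
Definition bump_to (C : set T) (m : nat) (x : T) : R :=
  Num.max 0 (1 - m%:R * distance_to C x).

Lemma bump_to_itv (C : set T) m x : C !=set0 -> 0 <= bump_to C m x <= 1.
Proof.
move=> C0; rewrite /bump_to le_max lexx /= ge_max ler01 /= gerBl.
by rewrite mulr_ge0 // distance_to_ge0.
Qed.

Lemma continuous_bump_to (C : set T) m : C !=set0 -> continuous (bump_to C m).
Proof.
move=> C0 x; apply: (@continuous_max R T (cst 0)) => /=; first exact: cvg_cst.
apply: cvgB; first exact: cvg_cst.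
by apply: cvgMr; exact: continuous_distance_to.
Qed.

Lemma cvg_bump_to (C : set T) x : C !=set0 -> closed C ->
  bump_to C m x @[m --> \oo] --> (\1_C x : R).
Proof.
move=> C0 cC; have [Cx|nCx] := pselect (C x).
  rewrite indicE mem_set //; apply: cvg_near_cst; apply: nearW => m.
  by rewrite /bump_to distance_to_eq0 // mulr0 subr0 max_r.
rewrite indicE memNset //; apply: cvg_near_cst.
have d0 := distance_to_gt0 C0 cC nCx.
have := nbhs_infty_ger (distance_to C x)^-1; apply: filterS => m hm.
by rewrite /bump_to max_l // subr_le0 -ler_pdivrMr // div1r.
Qed.

(** Strategies are measurable for the weak topology, whereas kernels require measurability of the
    mass of each Borel set. For closed sets this mass is a limit of integrals of bump functions; the
    open sets form a pi-system generating the Borel sets, so Dynkin induction does the rest. *)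
Lemma measurable_weak_setwise d (X : measurableType d) (H : set X)
    (f : X -> prob R T) (B : set (borel T)) :
  measurable_fun H (f : X -> borel (prob R T)) -> measurable B ->
  measurable_fun H (fun x => f x B).
Proof.
move=> mf.
have closedP C : closed C -> measurable_fun H (fun x => f x C).
  (* The bump functions need a nonempty set, because distances are infima over it. *)
  have [->|/set0P C0] := eqVneq C set0.
    by under eq_fun do rewrite measure0; move=> _; exact: measurable_cst.
  move=> cC; have mC := borel_closed cC.
  apply: (emeasurable_fun_cvg (fun m x => (\int[f x]_y bump_to C m y)%:E)).
    move=> m; apply/measurable_EFinP; apply: measurable_weak_integral => //.
      exact: continuous_bump_to.
    exists 1; split => // M M1 x _ /=.
    have /andP[b0 b1] := bump_to_itv m x C0.
    by rewrite ger0_norm // (le_trans b1) // ltW.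
  move=> x Hx.
  have mb m : measurable_fun [set: borel T] (fun y => (bump_to C m y)%:E).
    apply/measurable_EFinP; apply: borel_within_continuous_real => //.
    by apply: continuous_subspaceT; exact: continuous_bump_to.
  have bE m : (\int[f x]_y bump_to C m y)%:E =
      (\int[f x]_y (bump_to C m y)%:E)%E.
    rewrite /Rintegral fineK // ge0_fin_numE; last first.
      apply: integral_ge0 => y _.
      by rewrite lee_fin; have /andP[] := bump_to_itv m y C0.
    apply: (@le_lt_trans _ _ (\int[f x]_y 1%:E)%E); last first.
      by rewrite integral_cst //= probability_setT mule1 ltry.
    apply: ge0_le_integral => //.
    - by move=> y _; rewrite lee_fin; have /andP[] := bump_to_itv m y C0.
    - by move=> y _; rewrite lee_fin; have /andP[] := bump_to_itv m y C0.
  rewrite (_ : f x C = \int[f x]_y (\1_C y)%:E)%E; last first.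
    by rewrite integral_indic // setIT.
  under eq_cvg do rewrite bE.
  apply: (@dominated_cvg _ _ _ (f x) setT measurableT
    (fun m y => (bump_to C m y)%:E) (fun y => (\1_C y)%:E) (cst 1%:E)) => //.
  - by move=> y _; apply: cvg_EFin; [exact: nearW|exact: cvg_bump_to].
  - exact: finite_measure_integrable_cst.
  - move=> m y _; have /andP[b0 b1] := bump_to_itv m y C0.
    by rewrite abse_EFin lee_fin ger0_norm.
move=> mB; apply: (@dynkin_induction _ (borel T) (@open T)
  (fun S => measurable_fun H (fun x => f x S)) _ _ _ _ _ _ B mB).
- by [].
- by move=> U V; exact: openI.
- by under eq_fun do rewrite probability_setT; exact: measurable_cst.
- move=> U oU.
  have mU := borel_open oU.
  rewrite (_ : (fun x => f x U) = (fun x => 1 - f x (~` U))%E).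
    apply: emeasurable_funB; first exact: measurable_cst.
    by apply: closedP; exact: open_closedC.
  apply/funext => x; rewrite -[X in f x X]setCK probability_setC //.
  exact: measurableC.
- move=> S mS hS.
  rewrite (_ : (fun x => f x (~` S)) = (fun x => 1 - f x S)%E).
    by apply: emeasurable_funB => //; exact: measurable_cst.
  by apply/funext => x; rewrite probability_setC.
- move=> F mF tF hF.
  rewrite (_ : (fun x => _) = (fun x => \sum_(0 <= k <oo) f x (F k))%E).
    exact: ge0_emeasurable_sum.
  apply/funext => x; rewrite measure_bigcup //.
  by apply: eq_eseriesl => k; rewrite in_setT.
Qed.

End weak_measurability.

(** * Probability kernels and their products *)

Section kernels.
Variable R : realType.

Definition is_kernel d d' (X : measurableType d) (Y : measurableType d')
    (k : X -> probability Y R) :=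
  forall B, measurable B -> measurable_fun [set: X] (fun x => k x B).

Lemma is_kernel_measurable d d' (X : measurableType d) (Y : measurableType d')
    (k : X -> probability Y R) : is_kernel k ->
  measurable_fun [set: X] (k : X -> pprobability Y R).
Proof.
move=> mk; apply: (measurability (@pset _ _ _ : set (set (pprobability Y R)))) => //.
move=> _ [_ [r r01] [B mB <-]] <-.
have := mk B mB measurableT `]-oo, r%:E[%classic.
by apply; exact: emeasurable_itv.
Qed.

Section bind.
Context d1 d2 d3 (X : measurableType d1) (Y : measurableType d2)
  (Z : measurableType d3).
Variables (l : X -> probability Y R) (k : X * Y -> probability Z R).
Hypotheses (ml : is_kernel l) (mk : is_kernel k).

Definition bind_measure (x : X) : set Z -> \bar R :=
  (kprobability (is_kernel_measurable ml) \;
   kprobability (is_kernel_measurable mk))%E x.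

Let bind_setT x : bind_measure x setT = 1%E.
Proof.
rewrite /bind_measure /= /kcomp /=.
under eq_integral do rewrite probability_setT.
by rewrite integral_cst //= probability_setT mule1.
Qed.

HB.instance Definition _ x := Measure.on (bind_measure x).
HB.instance Definition _ x :=
  Measure_isProbability.Build _ _ _ (bind_measure x) (bind_setT x).

Lemma kernel_bind : exists2 m : X -> probability Z R, is_kernel m &
  forall x B, m x B = (\int[l x]_y k (x, y) B)%E.
Proof.
exists (fun x => bind_measure x : probability Z R) => // B mB.
exact: (measurable_kernel (kprobability (is_kernel_measurable ml) \;
   kprobability (is_kernel_measurable mk))%E).
Qed.

End bind.

Lemma is_kernel_dirac d d' (X : measurableType d) (Y : measurableType d')
    (f : X -> Y) : measurable_fun [set: X] f ->
  is_kernel (fun x => \d_(f x) : probability Y R).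
Proof.
move=> mf B mB; exact: (measurable_kernel (kdirac mf) B mB).
Qed.

Lemma is_kernel_comp d d' d'' (W : measurableType d'') (X : measurableType d)
    (Y : measurableType d') (k : X -> probability Y R) (f : W -> X) :
  is_kernel k -> measurable_fun [set: W] f -> is_kernel (k \o f).
Proof. by move=> mk mf B mB; exact: measurableT_comp (mk B mB) mf. Qed.

Lemma kernel_image d1 d2 d3 (X : measurableType d1) (Y : measurableType d2)
    (Z : measurableType d3) (l : X -> probability Y R) (phi : X * Y -> Z) :
  is_kernel l -> measurable_fun setT phi ->
  exists2 m : X -> probability Z R, is_kernel m &
    forall x B, measurable B -> m x B = l x [set y | B (phi (x, y))].
Proof.
move=> ml mphi; have [m mm mE] := kernel_bind ml (is_kernel_dirac mphi).
exists m => // x B mB; rewrite mE.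
have mphix : measurable_fun setT (fun y => phi (x, y)).
  by apply: (measurableT_comp mphi); exact: measurable_pair1.
have mB' : measurable [set y | B (phi (x, y))].
  by rewrite -[X in measurable X]setTI; exact: mphix.
transitivity (\int[l x]_y (\1_[set y | B (phi (x, y))] y)%:E)%E; last first.
  by rewrite integral_indic // setIT.
by apply: eq_integral => y _; rewrite /= diracE indicE; congr (_%:R%:E);
  apply/idP/idP; rewrite !inE.
Qed.

End kernels.

Section product_kernels.
Variable R : realType.

Lemma measurable_box (n : nat) (K : 'I_n -> ptopologicalType)
    (D : pred 'I_n) (B : forall i, set (borel (K i))) :
  (forall i, measurable (B i)) ->
  measurable ([set z | forall i, D i -> B i (z i)] :
    set (borel (prod_topology K))).
Proof.
move=> mB.
rewrite (_ : mkset _ = \bigcap_(i in [set i | D i]) (@proj _ K i @^-1` B i)).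
  apply: fin_bigcap_measurable; first exact: finite_finset.
  move=> i _; rewrite -[X in measurable X]setTI.
  by apply: (@borel_continuous (prod_topology K) (K i) (@proj _ K i)
    (@proj_continuous _ K i)).
by apply/seteqP; split=> z h i Di; exact: h.
Qed.

Lemma measurable_full_box (n : nat) (K : 'I_n -> ptopologicalType)
    (B : forall i, set (borel (K i))) : (forall i, measurable (B i)) ->
  measurable ([set z | forall i, B i (z i)] : set (borel (prod_topology K))).
Proof.
move=> /(@measurable_box n K predT).
rewrite (_ : mkset _ = [set z | forall i, B i (z i)]) //.
by apply/seteqP; split=> z h i => [|_]; exact: h.
Qed.

Lemma box_kernel (n : nat) (K : 'I_n -> ptopologicalType)
    d (X : measurableType d) (p : forall i, X -> prob R (K i)) :
  (forall i, exists W, @countable_base (K i) W) ->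
  (forall i, is_kernel (p i)) ->
  exists2 q : X -> prob R (prod_topology K), is_kernel q &
    forall x (B : forall i, set (borel (K i))), (forall i, measurable (B i)) ->
      q x [set z | forall i, B i (z i)] = (\prod_(i < n) p i x (B i))%E.
Proof.
move=> bK kp.
(* The coordinates of a fixed point are randomized one after the other. *)
suff /(_ n (leqnn n)) [q kq qE] : forall m, (m <= n)%N ->
    exists2 q : X -> prob R (prod_topology K), is_kernel q &
    forall x (B : forall i, set (borel (K i))), (forall i, measurable (B i)) ->
      q x [set z | forall i : 'I_n, (i < m)%N -> B i (z i)] =
      (\prod_(i < n | (i < m)%N) p i x (B i))%E.
  exists q => // x B mB.
  rewrite (_ : mkset _ = [set z | forall i : 'I_n, (i < n)%N -> B i (z i)]).
    by rewrite qE //; apply: eq_bigl => i; rewrite ltn_ord.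
  by apply/seteqP; split=> z h i => [_|]; exact: h.
elim=> [_|m IHm mn].
  exists (fun=> dirac_prob R point); first by move=> B _; exact: measurable_cst.
  move=> x B mB; rewrite big_pred0 // (_ : mkset _ = setT) ?probability_setT //.
  by apply/seteqP; split.
have [q kq qE] := IHm (ltnW mn).
pose i0 := Ordinal mn.
have kp' : is_kernel (p i0 \o @fst X (borel (prod_topology K))).
  by apply: is_kernel_comp (kp i0) _; exact: measurable_fst.
(* One induction step redraws coordinate [i0] of the point drawn so far, independently according to
   [p i0]. *)
pose phi (a : (X * borel (prod_topology K)) * borel (K i0)) :
  borel (prod_topology K) := dfwith a.1.2 i0 a.2.
have mphi : measurable_fun setT phi.
  have [W bW] := bK i0.
  have cpsi := @dfwith2_continuous _ K i0.
  pose chi (a : (X * borel (prod_topology K)) * borel (K i0)) :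
    (borel (prod_topology K) * borel (K i0))%type := (a.1.2, a.2).
  have mchi : measurable_fun setT chi.
    apply: measurable_fun_pair; last exact: measurable_snd.
    exact: measurableT_comp.
  exact: (measurableT_comp (borel_continuous cpsi)
    (measurableT_comp (measurable_prod_borel bW) mchi)).
have [k kk kE] := kernel_image kp' mphi.
have [q' kq' q'E] := kernel_bind kq kk.
exists q' => // x B mB.
pose Bm := [set z : prod_topology K | forall i : 'I_n, (i < m)%N -> B i (z i)].
have mBm : measurable (Bm : set (borel (prod_topology K))).
  by apply: (@measurable_box n K (fun i => (i < m)%N)).
(* Only points of [Bm] contribute, each with the same factor [p i0 x (B i0)]; so the integral is
   that of a constant over [Bm]. *)
rewrite q'E (_ : (\int[_]_y _)%E =
    (\int[q x]_(z in Bm) cst (p i0 x (B i0)) z)%E).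
  rewrite integral_cst // (_ : (q x : {measure set _ -> \bar R}) Bm =
    \prod_(i < n | (i < m)%N) p i x (B i))%E; last exact: qE.
  rewrite [RHS](bigD1 i0) //=; congr (_ * _)%E.
  apply: eq_bigl => i; rewrite -(inj_eq val_inj) /= ltnS.
  by rewrite ltn_neqAle andbC.
rewrite [RHS]integral_mkcond; apply: eq_integral => z _.
rewrite kE; last exact: (@measurable_box n K (fun i => (i < m.+1)%N)).
rewrite /= /phi /= patchE; case: ifPn => [/set_mem zB|/negP zB].
  congr (p i0 x _); apply/seteqP; split=> y.
    by move/(_ i0); rewrite dfwithin; apply.
  move=> By i; case: (dfwithP z y i) => // j ij; rewrite ltnS => jm.
  apply: zB; rewrite ltn_neqAle jm andbT.
  by apply: contraNneq ij => mj; apply/eqP/val_inj.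
rewrite (_ : mkset _ = set0) ?measure0 //; apply/seteqP; split=> // y h.
apply: zB; rewrite inE => i im; have := h i (ltnW im).
by rewrite dfwithout // -(inj_eq val_inj) /= gtn_eqF.
Qed.

Lemma kernel_semidirect (T U : ptopologicalType) (W : nat -> set U)
    (la : prob R T) (l : borel T -> prob R U) :
  countable_base W -> is_kernel l ->
  exists pi : prob R (T * U)%type, forall (A : set (borel T)) (B : set (borel U)),
    measurable A -> measurable B ->
    pi (A `*` B) = (\int[la]_(x in A) l x B)%E.
Proof.
move=> bW kl.
have [m km mE] := kernel_image kl (measurable_prod_borel bW).
(* [kernel_bind] composes kernels, so [la] enters as a constant kernel from a one-point space. *)
have kla : is_kernel (fun _ : unit => la) by move=> B _; exact: measurable_cst.
have km' : is_kernel (m \o @snd unit (borel T)).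
  by apply: is_kernel_comp km _; exact: measurable_snd.
have [pi _ piE] := kernel_bind kla km'.
exists (pi tt) => A B mA mB; rewrite piE [RHS]integral_mkcond.
apply: eq_integral => x _; rewrite /= mE; last first.
  rewrite (_ : A `*` B = fst @^-1` A `&` snd @^-1` B) //.
  apply: measurableI; rewrite -[X in measurable X]setTI.
    by apply: (@borel_continuous (T * U)%type T fst) => // z; exact: cvg_fst.
  by apply: (@borel_continuous (T * U)%type U snd) => // z; exact: cvg_snd.
rewrite patchE; case: ifPn => [/set_mem Ax|/negP nA].
  by congr (l x _); apply/seteqP; split=> y => [[]//|By]; split.
rewrite (_ : mkset _ = set0) ?measure0 //; apply/seteqP; split=> // y [/= Ax _].
by apply: nA; rewrite inE.
Qed.

End product_kernels.

(** * Histories and continuations *)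

Section polish_spaces.
Variables (R : realType) (T : ptopologicalType).

Lemma polish_countable_base : polish R T -> exists W, @countable_base T W.
Proof.
by move=> [[D cD dD] [d md _]]; exact: separable_countable_base md _ cD dD.
Qed.

Lemma metrizable_closed1 (x : T) : metrizable R T -> closed [set x].
Proof.
move=> [d md]; apply: accessible_closed_set1; apply: hausdorff_accessible.
exact: metrizes_hausdorff md.
Qed.

Lemma polish_metrizable : polish R T -> metrizable R T.
Proof. by move=> [_ [d md _]]; exists d. Qed.

End polish_spaces.

Section histories.
Variables (R : realType) (n : nat) (G : game R n).

Local Notation prehistory := (prehistory G).
Local Notation history := (history (act G)).
Local Notation Hinf := (Hinf (act G)).

Lemma trunc_continuous t : continuous (fun z : plays G => trunc z t).
Proof.
have c1 k : continuous (fun z : plays G => z.1 k).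
  move=> z; apply: (@cvg_comp _ _ _ fst (@proj _ (stage_action G) k) _ (nbhs z.1)).
    exact: cvg_fst.
  exact: proj_continuous.
have c2 k : continuous (fun z : plays G => z.2 k).
  move=> z; apply: (@cvg_comp _ _ _ snd (@proj _ (chance G) k) _ (nbhs z.2)).
    exact: cvg_snd.
  exact: proj_continuous.
elim: t => [|t IHt] z /=.
  by apply: cvg_pair; [exact: (c1 0%N z)|exact: (c2 0%N z)].
exact: (cvg_pair (IHt z) (cvg_pair (c1 t.+1 z) (c2 t.+1 z))).
Qed.

Lemma trunc_inj_le (z z' : plays G) t k : (k <= t)%N ->
  trunc z t = trunc z' t -> z.1 k = z'.1 k /\ z.2 k = z'.2 k.
Proof.
elim: t k => [|t IHt] k /=; first by rewrite leqn0 => /eqP -> [-> ->].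
by rewrite leq_eqVlt => /predU1P[-> [_ -> ->]//|kt [+ _ _]]; exact: IHt.
Qed.

Lemma eq_trunc (z z' : plays G) t :
  (forall k, (k <= t)%N -> z.1 k = z'.1 k /\ z.2 k = z'.2 k) ->
  trunc z t = trunc z' t.
Proof.
elim: t => [|t IHt] h /=; first by have [-> ->] := h 0%N (leqnn _).
rewrite IHt => [|k kt]; last by apply: h; exact: leqW.
by have [-> ->] := h t.+1 (leqnn _).
Qed.

Lemma closed1_prehistory t (h : prehistory t) : closed [set h].
Proof.
have c1 k (s : chance G k) : closed [set s].
  by apply: (@metrizable_closed1 R); exact/polish_metrizable/chance_polish.
have cX (T U : topologicalType) (A : set T) (B : set U) :
    closed A -> closed B -> closed (A `*` B).
  move=> cA cB; rewrite (_ : A `*` B = fst @^-1` A `&` snd @^-1` B) //.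
  apply: closedI; apply: closed_comp => // z _; [exact: cvg_fst|exact: cvg_snd].
have pairE (T U : Type) (a : T) (b : U) : [set (a, b)] = [set a] `*` [set b].
  by apply/seteqP; split=> [_ ->//|[? ?] [/= -> ->]].
elim: t h => [|t IHt].
  move=> [x s]; rewrite pairE; apply: cX; last exact: (c1 0%N s).
  by apply: (@metrizable_closed1 R); exact: start_metrizable.
move=> [h [x s]]; rewrite !pairE.
apply: (cX _ _ _ _ (IHt h)); apply: (cX _ _ _ _ _ (c1 _ s)).
rewrite (_ : [set x] = [set y : joint_action G t | forall i, [set x i] (y i)]).
  apply: (@closed_box _ _ (fun i => [set x i])) => i; apply: (@metrizable_closed1 R).
  exact/polish_metrizable/action_polish.
apply/seteqP; split=> [_ ->//|y xy]; apply: functional_extensionality_dep => i.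
exact: xy.
Qed.

(** Closed graph property: upper hemicontinuity and compactness give the actions a feasible limit
    along an ultrafilter, and Hausdorffness identifies it with the given limit. *)
Lemma closed_history t : closed (history t).
Proof.
elim: t => [|t IHt]; first exact: closedT.
apply: closed_ultra => F [h [x s]] FU FH Fx.
have Fh : fst @ F --> h.
  by move=> V hV; apply: Fx; exact: (cvg_fst hV).
have Hh : history t h.
  apply: (@closed_cvg _ _ F ultra_proper fst _ IHt _ h Fh).
  by apply: filterS FH => y [].
split => // i /=.
have [|a Aa Fa] := @uhc_ultra_cvg _ _ _ (history t) (act G t i) F fst
    (fun y => y.2.1 i) h FU (@act_uhc _ _ G t i) (@act_compact _ _ G t i h Hh) Hh Fh.
  by apply: filterS FH => y [? ?]; split.
have Fxi : (fun y : prehistory t.+1 => y.2.1 i) @ F --> x i.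
  have c : continuous (fun y : prehistory t.+1 => y.2.1 i).
    move=> y; apply: (@cvg_comp _ _ _ (fun y : prehistory t.+1 => y.2.1)
      (@proj _ (action G t) i) _ (nbhs y.2.1)); last exact: proj_continuous.
    apply: (@cvg_comp _ _ _ snd fst _ (nbhs y.2)); first exact: cvg_snd.
    exact: cvg_fst.
  move=> V xV; apply: (Fx ((fun y : prehistory t.+1 => y.2.1 i) @^-1` V)).
  exact: (c (h, (x, s)) V xV).
suff -> : x i = a by [].
have [d md] := polish_metrizable (@action_polish _ _ G t i).
exact: (@cvg_unique _ (metrizes_hausdorff md) _ (fmap_proper_filter _ _) _ _ Fxi Fa).
Qed.

Lemma closed_Hinf : closed Hinf.
Proof.
rewrite (_ : Hinf = \bigcap_t ((fun z => trunc z t) @^-1` history t)).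
  apply: closed_bigI => t _; apply: closed_comp => [z _|].
    exact: trunc_continuous.
  exact: closed_history.
by apply/seteqP; split=> z h t => [_|]; exact: h.
Qed.

Lemma history_trunc_le (z : plays G) t k : (k <= t)%N ->
  history t (trunc z t) -> history k (trunc z k).
Proof.
elim: t k => [|t IHt] k; first by rewrite leqn0 => /eqP ->.
by rewrite leq_eqVlt => /predU1P[-> //|kt [/= + _]]; exact: IHt.
Qed.

Lemma trunc_surj t (h : prehistory t) : exists z : plays G, trunc z t = h.
Proof.
elim: t h => [|t IHt] [h /= s].
  by exists (dfwith point 0%N h, dfwith point 0%N s); rewrite /= !dfwithin.
have [z zh] := IHt h.
exists (dfwith z.1 t.+1 s.1, dfwith z.2 t.+1 s.2).
rewrite /= !dfwithin -surjective_pairing; congr (_, _).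
rewrite -zh; apply: eq_trunc => k kt /=.
by rewrite !dfwithout // gtn_eqF.
Qed.

Lemma history_extends t (h : prehistory t) : history t h ->
  exists z, Hinf z /\ trunc z t = h.
Proof.
move=> Hh; have [z0 z0h] := trunc_surj h.
pose sel k (h' : prehistory k) : stage_action G k.+1 := fun i => get (act G k i h').
(* The selection at stage [j] depends on the play built so far, so whole plays are carried along.
   Beyond stage [t], passing from [Z j] to [Z j.+1] alters coordinate [j.+1] only, so the diagonal
   [z] agrees with [Z k] up to stage [k]. *)
pose Z := fix Z k : plays G := if k is j.+1 then
  if (t <= j)%N then (dfwith (Z j).1 j.+1 (sel j (trunc (Z j) j)), (Z j).2)
  else Z j else z0.
have Z2 j : (Z j).2 = z0.2 by elim: j => //= j IHj; case: ifP.
have Zle j k : (k <= j)%N -> (Z j).1 k = (Z k).1 k.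
  elim: j => [|j IHj]; first by rewrite leqn0 => /eqP ->.
  rewrite leq_eqVlt => /predU1P[-> //|kj].
  rewrite -IHj //=; case: ifP => //= _.
  by rewrite dfwithout // gtn_eqF.
pose z : plays G := (fun k => (Z k).1 k, z0.2).
have zZ k : trunc z k = trunc (Z k) k.
  by apply: eq_trunc => m mk /=; rewrite (Zle k m mk) Z2.
have Z0 k : (k <= t)%N -> Z k = z0.
  by elim: k => [//|k IHk] kt /=; rewrite leqNgt kt /= IHk // ltnW.
have zt : trunc z t = h by rewrite zZ Z0.
have Hge k : history (t + k) (trunc z (t + k)).
  elim: k => [|k IHk]; first by rewrite addn0 zt.
  rewrite addnS; split => //= i; rewrite leq_addr /= dfwithin -zZ /sel.
  by apply: getPex; exact: act_nonempty IHk.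
exists z; split => // k; have [kt|tk] := leqP k t.
  by apply: history_trunc_le kt _; rewrite zt.
by rewrite -(subnKC (ltnW tk)).
Qed.

Hypothesis hnat : without_nature G.

Lemma chance_unique t (s s' : chance G t.+1) : s = s'.
Proof.
have [a Ea] := hnat t.
have sE y : y = a by have : [set: chance G t.+1] y by []; rewrite Ea.
by rewrite (sE s) (sE s').
Qed.

Variable T0 : nat.
Hypothesis hT0 : forall t, (T0 <= t)%N -> forall (h : prehistory t), history t h ->
  forall i, single_point (act G t i h).

Lemma play_unique t (z z' : plays G) : (T0 <= t)%N -> Hinf z -> Hinf z' ->
  trunc z t = trunc z' t -> z = z'.
Proof.
move=> Tt Hz Hz' zz'.
have zz'k k : trunc z (t + k) = trunc z' (t + k).
  elim: k => [|k IHk]; first by rewrite addn0.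
  rewrite addnS /= IHk; congr (_, (_, _)); last exact: chance_unique.
  apply: functional_extensionality_dep => i.
  have [_ /(_ i) /= Az] := Hz (t + k).+1.
  have [_ /(_ i) /= Az'] := Hz' (t + k).+1.
  have [a Aa] := hT0 (leq_trans Tt (leq_addr k t)) (Hz' (t + k)%N) i.
  by move: Az Az'; rewrite IHk Aa => -> ->.
have zk k : z.1 k = z'.1 k /\ z.2 k = z'.2 k.
  by apply: trunc_inj_le (zz'k k); rewrite leq_addl.
case: z z' zk {Hz Hz' zz' zz'k} => [x s] [x' s'] /= zk.
by congr (_, _); apply: functional_extensionality_dep => k; have [] := zk k.
Qed.

(** An arbitrary choice before stage [T0]; from [T0] on it is the only play through the history, by
    [play_unique]. *)
Definition continuation t (h : prehistory t) : plays G :=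
  get [set z | Hinf z /\ trunc z t = h].

Lemma continuationP t (h : prehistory t) : history t h ->
  Hinf (continuation h) /\ trunc (continuation h) t = h.
Proof. by move=> /history_extends/getPex. Qed.

Lemma continuation_trunc t z : (T0 <= t)%N -> Hinf z ->
  continuation (trunc z t) = z.
Proof.
move=> Tt Hz; have [Hc ct] := continuationP (Hz t).
exact: play_unique Hc Hz ct.
Qed.

(** Coordinates up to stage [t] are read off the history. Beyond it actions are forced, and an upper
    hemicontinuous correspondence with one-point values is a continuous map, so convergence
    propagates from each stage to the next. *)
Lemma continuation_continuous t : (T0 <= t)%N ->
  {within history t, continuous (@continuation t)}.
Proof.
move=> Tt; apply: within_continuous_ultra => h F Hh FU FH Fh.
have FF : ProperFilter F by exact: ultra_proper.
have [Hc ct] := continuationP Hh.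
pose c h' := continuation (h' : prehistory t).
have step k : (fun h' => trunc (c h') k.+1) @ F --> trunc (c h) k.+1 ->
    (fun h' => trunc (c h') k) @ F --> trunc (c h) k.
  move=> ck V hV; apply: (ck (fst @^-1` V)).
  exact: (cvg_fst hV).
have up k : (T0 <= k)%N -> (fun h' => trunc (c h') k) @ F --> trunc (c h) k ->
    (fun h' => trunc (c h') k.+1) @ F --> trunc (c h) k.+1.
  move=> Tk ck.
  have cs : (fun h' => (c h').2 k.+1) @ F --> (c h).2 k.+1.
    rewrite (_ : (fun h' => (c h').2 k.+1) = fun=> (c h).2 k.+1).
      exact: cvg_cst.
    by apply/funext => h'; exact: chance_unique.
  have cx : (fun h' => (c h').1 k.+1 : joint_action G k) @ F --> (c h).1 k.+1.
    apply: (@cvg_prod_topology _ (action G k)) => i.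
    have [|a Aa Fa] := @uhc_ultra_cvg _ _ _ (history k) (act G k i) F
      (fun h' => trunc (c h') k) (fun h' => (c h').1 k.+1 i) (trunc (c h) k) FU
      (@act_uhc _ _ G k i) (@act_compact _ _ G k i _ (Hc k)) (Hc k) ck.
      apply: filterS FH => h' Hh'; have [Hc' _] := continuationP Hh'.
      by split; [exact: Hc'|have [_] := Hc' k.+1; exact].
    have [b Ab] := hT0 Tk (Hc k) i.
    have [_ /(_ i) /=] := Hc k.+1.
    by rewrite Ab => ->; move: Aa; rewrite Ab => <-.
  exact: (cvg_pair ck (cvg_pair cx cs)).
have base m : m = t -> (fun h' => trunc (c h') m) @ F --> trunc (c h) m.
  move=> ->; rewrite ct => V hV; have FV := Fh V hV.
  apply: filterS (filterI FH FV) => h' [Hh' Vh'].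
  by rewrite /preimage /= /c; have [_ ->] := continuationP Hh'.
have all k : (fun h' => trunc (c h') k) @ F --> trunc (c h) k.
  have [kt|tk] := leqP k t.
    have := base _ (subnKC kt); elim: (t - k)%N => [|d IHd].
      by rewrite addn0.
    by rewrite addnS => /step.
  rewrite -(subnKC (ltnW tk)); elim: (k - t)%N => [|d IHd].
    by apply: base; rewrite addn0.
  by rewrite addnS; apply: up => //; rewrite (leq_trans Tt) // leq_addr.
have snd2 k : (fun h' => ((c h').1 k, (c h').2 k)) @ F --> ((c h).1 k, (c h).2 k).
  case: k => [|k]; first exact: (all 0%N).
  by move=> V hV; apply: (all k.+1 (snd @^-1` V)); exact: (cvg_snd hV).
have c1 : (fun h' => (c h').1) @ F --> (c h).1.
  apply: (@cvg_prod_topology _ (stage_action G)) => k V hV.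
  by apply: (snd2 k (fst @^-1` V)); exact: (cvg_fst hV).
have c2 : (fun h' => (c h').2) @ F --> (c h).2.
  apply: (@cvg_prod_topology _ (chance G)) => k V hV.
  by apply: (snd2 k (snd @^-1` V)); exact: (cvg_snd hV).
move=> V hV.
have hV' : nbhs ((c h).1, (c h).2) V by rewrite -surjective_pairing.
have : F ((fun h' => ((c h').1, (c h').2)) @^-1` V) by exact: (cvg_pair c1 c2 hV').
by apply: (@filterS _ F) => h'; rewrite /preimage /= -surjective_pairing.
Qed.

End histories.

(** * Outcome laws *)

Section full_sets.
Context d (T : measurableType d) (R : realType) (P : probability T R).
Local Open Scope ereal_scope.

Lemma probability_setI_eq1 (A D : set T) : measurable A -> measurable D ->
  P D = 1 -> P (A `&` D) = P A.
Proof.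
move=> mA mD /(probability_eq1C P mD) D0.
rewrite (measureDI P mA mD) [X in X + _](_ : _ = 0) ?add0e //.
apply/eqP; rewrite eq_le measure_ge0 andbT -D0; apply: le_measure.
- by rewrite inE; exact: measurableD.
- by rewrite inE; exact: measurableC.
- by move=> x [].
Qed.

Lemma probability_eq_on (A B D : set T) : measurable A -> measurable B ->
  measurable D -> P D = 1 -> A `&` D = B `&` D -> P A = P B.
Proof.
by move=> mA mB mD PD AB; rewrite -(probability_setI_eq1 mA mD) // AB
  probability_setI_eq1.
Qed.

End full_sets.

Lemma continuous_pairr (T U : topologicalType) (y : U) :
  continuous (fun x : T => (x, y)).
Proof. by move=> x; apply: cvg_pair; [exact: cvg_id|exact: cvg_cst]. Qed.

Lemma continuous_pairl (T U : topologicalType) (x : T) :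
  continuous (fun y : U => (x, y)).
Proof. by move=> y; apply: cvg_pair; [exact: cvg_cst|exact: cvg_id]. Qed.

Section outcome_laws.
Variables (R : realType) (n : nat) (G : game R n).

Local Notation prehistory := (prehistory G).
Local Notation history := (history (act G)).
Local Notation Hinf := (Hinf (act G)).
Local Notation moves k := (joint_action G k * chance G k.+1)%type.

Lemma moves_countable_base k : exists W, @countable_base (moves k) W.
Proof.
have [V bV] : exists V, @countable_base (joint_action G k) V.
  apply: (@box_countable_base _ (action G k)) => i.
  exact: polish_countable_base (@action_polish _ _ G k i).
have [W bW] := polish_countable_base (@chance_polish _ _ G k.+1).
exact: prod_countable_base bV bW.
Qed.

Lemma product_measure_eq1 k (mu : forall i, prob R (action G k i))
    (nu : prob R (chance G k.+1)) (pi : prob R (moves k))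
    (B : forall i, set (borel (action G k i))) :
  is_product_measure mu nu pi -> (forall i, measurable (B i)) ->
  (forall i, mu i (B i) = 1%E) ->
  pi ([set x : joint_action G k | forall i, B i (x i)] `*` setT) = 1%E.
Proof.
move=> prod mB muB; rewrite prod // probability_setT mule1.
by rewrite big1 // => i _; exact: muB.
Qed.

Lemma trunc_measurable t (B : set (borel (prehistory t))) : measurable B ->
  measurable ((fun z => trunc z t) @^-1` B : set (borel (plays G))).
Proof.
move=> mB; rewrite -[X in measurable X]setTI.
exact: (borel_continuous (@trunc_continuous R n G t)).
Qed.

Lemma fst_measurable (T U : ptopologicalType) (B : set (borel T)) :
  measurable B -> measurable (B `*` setT : set (borel (T * U)%type)).
Proof.
move=> mB; rewrite (_ : B `*` setT = setT `&` fst @^-1` B); last first.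
  by apply/seteqP; split=> [[x y] []|[x y] []].
by apply: (@borel_continuous (T * U)%type T fst) => // z; exact: cvg_fst.
Qed.

Hypothesis hnat : without_nature G.

Lemma stage_kernel (p : profile G) k : is_profile p ->
  exists2 nu : borel (prehistory k) -> prob R (moves k), is_kernel nu &
    forall h, history k h ->
      is_product_measure (fun i => p i k h) (nature G k h) (nu h).
Proof.
move=> pp.
have mH : measurable (history k : set (borel (prehistory k))).
  by apply: borel_closed; exact: closed_history.
(* Strategies are constrained on histories only; a Dirac measure elsewhere makes the kernel total
   and measurable. *)
pose p' i (h : borel (prehistory k)) : prob R (action G k i) :=
  if h \in history k then p i k h else dirac_prob R point.
have kp' i : is_kernel (p' i).
  move=> B mB.
  rewrite (_ : (fun h => _) = (fun h : borel (prehistory k) =>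
    if h \in history k then p i k h B else (dirac_prob R point : prob R _) B));
    last by apply/funext => h; rewrite /p'; case: ifP.
  apply: measurable_fun_if => //.
  - by apply: (measurable_fun_bool true); rewrite setTI preimage_mem_true.
  - rewrite setTI preimage_mem_true.
    have [d md] := polish_metrizable (@action_polish _ _ G k i).
    exact: (measurable_weak_setwise md (proj1 (pp i k)) mB).
have [q kq qE] := box_kernel (fun i =>
  polish_countable_base (@action_polish _ _ G k i)) kp'.
(* Nature's space at this stage is a single point, so appending [point] amounts to taking the
   product with her law. *)
pose phi (a : borel (prehistory k) * borel (joint_action G k)) :
  borel (moves k) := (a.2, point).
have mphi : measurable_fun setT phi.
  have c := @continuous_pairr (joint_action G k) (chance G k.+1) point.
  exact: (measurableT_comp (borel_continuous c) measurable_snd).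
have [nu knu nuE] := kernel_image kq mphi.
exists nu => // h Hh B C mB mC.
have mBC : measurable ([set x : joint_action G k | forall i, B i (x i)] `*` C
    : set (borel (moves k))).
  rewrite (_ : _ `*` _ = ([set x : joint_action G k | forall i, B i (x i)] `*` setT)
    `&` (setT `&` snd @^-1` C)); last first.
    by apply/seteqP; split=> [[x y] []|[x y] [[? _] []]].
  apply: measurableI.
    by apply: fst_measurable; apply: (@measurable_full_box n (action G k)).
  by apply: (@borel_continuous (moves k) (chance G k.+1) snd) => // z;
    exact: cvg_snd.
rewrite nuE // /phi /=.
have -> : (\prod_(i < n) p i k h (B i))%E = (\prod_(i < n) p' i h (B i))%E.
  by apply: eq_bigr => i _; rewrite /p' mem_set.
have [Cp|nCp] := pselect (C point).
  have -> : C = setT.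
    by apply/seteqP; split=> // s _; rewrite (chance_unique hnat s point).
  rewrite probability_setT mule1 -qE //; congr (q h _).
  by apply/seteqP; split=> x //= [].
have -> : C = set0.
  by apply/seteqP; split=> // s; rewrite (chance_unique hnat s point).
rewrite measure0 mule0 (_ : mkset _ = set0) ?measure0 //.
by apply/seteqP; split=> x // [].
Qed.

Lemma support_box_eq1 (p : profile G) k (h : prehistory k) nu :
  is_profile p -> history k h ->
  is_product_measure (fun i => p i k h) (nature G k h) nu ->
  nu ([set x : joint_action G k | forall i, measure_support (p i k h) (x i)]
    `*` setT) = 1%E.
Proof.
move=> pp Hh prod; apply: (product_measure_eq1
  (B := fun i => measure_support (p i k h)) prod) => i.
  by apply: borel_closed; exact: support_closed.
have [W bW] := polish_countable_base (@action_polish _ _ G k i).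
exact: support_eq1 bW.
Qed.

Lemma composition_full (p : profile G) k (la : prob R (prehistory k))
    (nu : prehistory k -> prob R (moves k)) (pi : prob R (prehistory k.+1))
    (C : set (prehistory k.+1)) :
  is_profile p ->
  (forall h, history k h ->
    is_product_measure (fun i => p i k h) (nature G k h) (nu h)) ->
  is_composition (history k) la nu pi -> closed C ->
  (forall h (m : moves k), history k h ->
    (forall i, measure_support (p i k h) (m.1 i)) -> C (h, m)) ->
  pi C = 1%E.
Proof.
move=> pp prod comp cC hC; have [W bW] := moves_countable_base k.
apply: (composition_eq1 bW comp cC) => h Hh.
have cCh : closed [set m | C (h, m)].
  have /continuous_closedP := @continuous_pairl (prehistory k) (moves k) h.
  exact.
apply: probability_eq1S (support_box_eq1 pp Hh (prod h Hh)).
- apply: fst_measurable; apply: (@measurable_full_box n (action G k)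
    (fun i => measure_support (p i k h))) => i.
  by apply: borel_closed; exact: support_closed.
- exact: borel_closed.
- by move=> m [/= hm _]; exact: hC.
Qed.

Lemma composition_fst k (D : set (prehistory k)) (la : prob R (prehistory k))
    (nu : prehistory k -> prob R (moves k)) (pi : prob R (prehistory k.+1)) B :
  is_composition D la nu pi -> measurable (D : set (borel _)) ->
  la D = 1%E -> measurable (B : set (borel _)) -> pi (B `*` setT) = la B.
Proof.
move=> comp mD laD mB; rewrite comp //.
under eq_integral do rewrite probability_setT.
rewrite integral_cst ?mul1e; last exact: measurableI.
exact: (probability_setI_eq1 mB mD laD).
Qed.

Lemma history_support (p : profile G) k (h : prehistory k) (m : moves k) :
  is_profile p -> history k h ->
  (forall i, measure_support (p i k h) (m.1 i)) -> history k.+1 (h, m).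
Proof. by move=> pp Hh hm; split => // i; have [_ /(_ h Hh)] := pp i k; apply. Qed.

Variable T0 : nat.
Hypothesis hT0 : forall t, (T0 <= t)%N -> forall (h : prehistory t), history t h ->
  forall i, single_point (act G t i h).

Lemma outcome_law_exists (p : profile G) t (h : prehistory t) :
  is_profile p -> history t h -> exists tau, is_outcome_law p h tau.
Proof.
move=> pp Hh.
have mH k : measurable (history k : set (borel (prehistory k))).
  by apply: borel_closed; exact: closed_history.
pose nu k := projT1 (cid2 (stage_kernel k pp)).
have knu k : is_kernel (nu k) by rewrite /nu; case: cid2.
have nuP k h' : history k h' ->
    is_product_measure (fun i => p i k h') (nature G k h') (nu k h').
  by rewrite /nu; case: cid2 => /= ? ?; exact.
have sdE k (la : prob R (prehistory k)) : exists pi : prob R (prehistory k.+1),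
    forall (A : set (borel (prehistory k))) (B : set (borel (moves k))),
    measurable A -> measurable B ->
    pi (A `*` B) = (\int[la]_(x in A) nu k x B)%E.
  by have [W bW] := moves_countable_base k; exact: kernel_semidirect bW (knu k).
pose sd k la := projT1 (cid (sdE k la)).
have sdP k la := projT2 (cid (sdE k la)).
(* Outcome laws constrain the marginals from stage [t] on. Earlier ones are filled in from a play
   through [h], which makes [taus t] the Dirac measure at [h]. *)
pose taus := fix taus k : prob R (prehistory k) :=
  if k is j.+1 return prob R (prehistory k) then
    if (j < t)%N then dirac_prob R (trunc (continuation h) j.+1)
    else sd j (taus j)
  else dirac_prob R (trunc (continuation h) 0).
have [Hc ct] := continuationP Hh.
have taust B : taus t B = dirac_prob R h B.
  suff E k : (k <= t)%N -> taus k = dirac_prob R (trunc (continuation h) k).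
    by rewrite E // ct.
  by case: k => //= k ->.
have tausS k : (t <= k)%N -> taus k.+1 = sd k (taus k).
  by move=> tk /=; rewrite ltnNge tk.
(* The semidirect product integrates over all prehistories. It agrees with the composition over
   histories once [taus k] is known to live on them, and the composition in turn shows this for
   [taus k.+1]. *)
have step k : (t <= k)%N -> taus k (history k) = 1%E ->
    is_composition (history k) (taus k) (nu k) (taus k.+1).
  move=> tk tk1 A B mA mB; rewrite tausS // sdP //.
  rewrite (@ge0_negligible_integral _ _ _ (taus k) A (~` history k)) //.
  - by rewrite setDE setCK.
  - exact: measurableC.
  - exact: measurable_funTS (knu k B mB).
  - by apply/probability_eq1C.
have full k : taus (t + k)%N (history (t + k)%N) = 1%E.
  elim: k => [|k IHk].
    by rewrite addn0 taust /dirac_prob /= diracE mem_set.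
  rewrite addnS; apply: (composition_full pp (@nuP _) (step _ (leq_addr _ _) IHk)).
    exact: closed_history.
  by move=> h' m Hh' hm; exact: history_support hm.
have {}full k : (t <= k)%N -> taus k (history k) = 1%E.
  by move=> tk; rewrite -(subnKC tk).
have {}step k : (t <= k)%N -> is_composition (history k) (taus k) (nu k) (taus k.+1).
  by move=> tk; apply: step => //; exact: full.
have fstE k B : (t <= k)%N -> measurable (B : set (borel (prehistory k))) ->
    taus k.+1 (B `*` setT) = taus k B.
  by move=> tk mB; apply: (composition_fst (step k tk) (mH k) (full k tk)).
(* All moves after stage [K] are forced, so that the law is the image of its
   marginal on histories of stage [K] under [continuation]. *)
pose K := maxn t T0.
have tK : (t <= K)%N by exact: leq_maxl.
have TK : (T0 <= K)%N by exact: leq_maxr.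
pose c (a : unit * borel (prehistory K)) : borel (plays G) :=
  if a.2 \in history K then continuation a.2 else point.
have mc : measurable_fun setT c.
  pose c' (h' : borel (prehistory K)) : borel (plays G) :=
    if h' \in history K then continuation h' else point.
  suff mc' : measurable_fun setT c' by exact: (measurableT_comp mc' measurable_snd).
  apply: measurable_fun_if => //.
    by apply: (measurable_fun_bool true); rewrite setTI preimage_mem_true.
  rewrite setTI preimage_mem_true.
  exact: (borel_within_continuous (closed_history (G := G) (t := K))
    (continuation_continuous hnat hT0 TK)).
have kla : is_kernel (fun _ : unit => taus K) by move=> B _; exact: measurable_cst.
have [tau _ tauE] := kernel_image kla mc.
have mHinf : measurable (Hinf : set (borel (plays G))).
  by apply: borel_closed; exact: closed_Hinf.
have cE h' : history K h' -> c (tt, h') = continuation h'.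
  by move=> Hh'; rewrite /c mem_set.
have mcpre (B : set (borel (plays G))) : measurable B ->
    measurable ([set h' | B (c (tt, h'))] : set (borel (prehistory K))).
  move=> mB; rewrite -[X in measurable X]setTI.
  by apply: (measurableT_comp mc) => //; exact: measurable_pair1.
have tauHinf : tau tt Hinf = 1%E.
  rewrite tauE //; apply: probability_eq1S (full K tK) => //; first exact: mcpre.
  by move=> h' Hh' /=; rewrite cE //; have [] := continuationP Hh'.
exists (tau tt); split => //; exists taus, nu; split => //.
  by move=> k h' _; exact: nuP.
have tauK B : measurable (B : set (borel (prehistory K))) ->
    tau tt ((fun z => trunc z K) @^-1` B) = taus K B.
  move=> mB; rewrite tauE; last exact: trunc_measurable.
  apply: (@probability_eq_on _ (borel (prehistory K)) R (taus K) _ _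
    (history K)) => //.
  - exact: mcpre (trunc_measurable mB).
  - exact: full.
  - apply/seteqP; split=> h' /= [+ Hh']; rewrite cE //;
      by have [_ ->] := continuationP Hh'.
have down k : (t <= k)%N ->
    (forall B, measurable (B : set (borel (prehistory k.+1))) ->
      tau tt ((fun z => trunc z k.+1) @^-1` B) = taus k.+1 B) ->
    forall B, measurable (B : set (borel (prehistory k))) ->
      tau tt ((fun z => trunc z k) @^-1` B) = taus k B.
  move=> tk tauk B mB; rewrite -fstE // -tauk; last exact: fst_measurable.
  by congr (tau tt _); apply/seteqP; split=> z //= -[].
have up k : (K <= k)%N ->
    (forall B, measurable (B : set (borel (prehistory k))) ->
      tau tt ((fun z => trunc z k) @^-1` B) = taus k B) ->
    forall B, measurable (B : set (borel (prehistory k.+1))) ->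
      tau tt ((fun z => trunc z k.+1) @^-1` B) = taus k.+1 B.
  move=> Kk tauk B mB.
  have tk := leq_trans tK Kk; have Tk := leq_trans TK Kk.
  (* The histories of stage [k] whose forced successor lies in [B]; past [K] an event of stage
     [k.+1] is almost surely an event of stage [k]. *)
  pose B' := history k `&`
    ((fun z => trunc z k.+1) \o @continuation _ _ G k) @^-1` B.
  have mB' : measurable (B' : set (borel (prehistory k))).
    have cc := borel_within_continuous (closed_history (G := G) (t := k))
      (continuation_continuous hnat hT0 Tk).
    exact: (cc (mH k) _ (trunc_measurable mB)).
  transitivity (tau tt ((fun z => trunc z k) @^-1` B')).
    apply: (@probability_eq_on _ (borel (plays G)) R (tau tt) _ _ Hinf) => //.
    - exact: trunc_measurable.
    - exact: trunc_measurable.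
    - apply/seteqP; split=> z [Bz Hz]; split => //.
        split; first exact: Hz.
        by rewrite /preimage /= (continuation_trunc hnat hT0 Tk).
      by case: Bz => _; rewrite /preimage /= (continuation_trunc hnat hT0 Tk).
  rewrite tauk // -fstE //.
  apply: (@probability_eq_on _ (borel (prehistory k.+1)) R (taus k.+1) _ _
    (history k.+1)) => //.
  - exact: fst_measurable.
  - by apply: full; exact: leqW.
  have nextE h' : history k.+1 h' -> trunc (continuation h'.1) k.+1 = h'.
    move=> Hh'; have [Hc' ct'] := continuationP Hh'.
    by rewrite -[in RHS]ct' -[in LHS]ct' (continuation_trunc hnat hT0 Tk).
  apply/seteqP; split=> h' [Bh' Hh']; split => //.
    by case: Bh' => -[_ Bn] _; rewrite -(nextE _ Hh').
  split => //; split; first by case: Hh'.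
  by rewrite /preimage -[mkset _ _]/(B (trunc (continuation h'.1) k.+1)) nextE.
have le d : forall k, (t <= k)%N -> (k + d)%N = K ->
    forall B, measurable (B : set (borel (prehistory k))) ->
      tau tt ((fun z => trunc z k) @^-1` B) = taus k B.
  elim: d => [|d IHd] k tk; first by rewrite addn0 => ->.
  by rewrite addnS => kd; apply: down => //; apply: IHd; rewrite ?addSn // leqW.
have ge d : forall B, measurable (B : set (borel (prehistory (K + d)))) ->
      tau tt ((fun z => trunc z (K + d)) @^-1` B) = taus (K + d)%N B.
  elim: d => [|d IHd]; first by rewrite addn0.
  by rewrite addnS; apply: up => //; exact: leq_addr.
move=> k B tk mB; have [kK|Kk] := leqP k K.
  exact: (le (K - k)%N) (subnKC kK) _ mB.
by move: B mB; rewrite -(subnKC (ltnW Kk)); exact: ge.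
Qed.

End outcome_laws.

(** * Integrals under almost sure bounds *)

Section bounded_integrals.
Context d (T : measurableType d) (R : realType) (P : probability T R).
Variables (H E : set T) (u : T -> R) (c : R).
Hypotheses (mH : measurable H) (mE : measurable E).
Hypotheses (PH : P H = 1%E) (PE : P E = 1%E).
Hypotheses (mu : measurable_fun H u) (bu : [bounded u z | z in H]).

Let integrable_u : P.-integrable H (EFin \o u).
Proof.
apply: measurable_bounded_integrable => //.
exact: (le_lt_trans (probability_le1 P mH) (ltry 1)).
Qed.

Let RintegralE : \int[P]_(z in H) u z = \int[P]_(z in H `&` E) u z.
Proof.
rewrite /Rintegral (negligible_integral (N := ~` E)) //.
- by rewrite setDE setCK.
- exact: measurableC.
- by apply/(probability_eq1C P).
Qed.

Let mHE : measurable (H `&` E). Proof. exact: measurableI. Qed.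

Let PHE : P (H `&` E) = 1%E. Proof. exact: probability_eq1I. Qed.

Let integrable_uE : P.-integrable (H `&` E) (EFin \o u).
Proof. exact: integrableS integrable_u. Qed.

Let integrable_c : P.-integrable (H `&` E) (EFin \o cst c).
Proof. exact: finite_measure_integrable_cst. Qed.

Let Rintegral_c : \int[P]_(z in H `&` E) cst c z = c.
Proof.
rewrite Rintegral_cst //.
by rewrite (_ : (P : {measure set T -> \bar R}) (H `&` E) = 1%E) ?mulr1.
Qed.

Lemma Rintegral_le_const :
  (forall z, H z -> E z -> u z <= c) -> \int[P]_(z in H) u z <= c.
Proof.
move=> uc; rewrite RintegralE -[leRHS]Rintegral_c.
by apply: le_Rintegral => // z [Hz Ez]; exact: uc.
Qed.

Lemma Rintegral_ge_const :
  (forall z, H z -> E z -> c <= u z) -> c <= \int[P]_(z in H) u z.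
Proof.
move=> uc; rewrite RintegralE -[leLHS]Rintegral_c.
by apply: le_Rintegral => // z [Hz Ez]; exact: uc.
Qed.

(** The difference [c - u] is almost surely nonnegative and has integral zero, hence vanishes almost
    everywhere. *)
Lemma Rintegral_eq_const :
  (forall z, H z -> E z -> u z <= c) -> \int[P]_(z in H) u z = c ->
  exists F, [/\ measurable F, P F = 1%E & forall z, H z -> F z -> u z = c].
Proof.
move=> uc; rewrite RintegralE => uE.
have iB : \int[P]_(z in H `&` E) (c - u z) = 0.
  by rewrite (RintegralB mHE integrable_c integrable_uE) uE Rintegral_c subrr.
have mf : measurable_fun (H `&` E) (fun z => (c - u z)%:E).
  apply/measurable_EFinP; apply: measurable_funB; first exact: measurable_cst.
  exact: measurable_funS mu.
have /(ae_eq_integral_abs P mHE mf) [N [mN PN NS]] :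
    (\int[P]_(z in H `&` E) `|(c - u z)%:E| = 0)%E.
  rewrite (_ : (\int[P]_(z in H `&` E) _)%E =
    (\int[P]_(z in H `&` E) (c - u z)%:E)%E); last first.
    apply: eq_integral => z /set_mem[Hz Ez].
    by rewrite abse_EFin ger0_norm // subr_ge0; exact: uc.
  rewrite -(@fineK _ (\int[P]_(z in _) _)%E).
    by rewrite -[fine _]/(\int[P]_(z in H `&` E) (c - u z)) iB.
  apply: integrable_fin_num => //.
  exact: (integrableB mHE integrable_c integrable_uE).
exists (~` N `&` E); split.
- by apply: measurableI => //; exact: measurableC.
- apply: probability_eq1I => //; first exact: measurableC.
  by apply/probability_eq1C; [exact: measurableC|rewrite setCK].
- move=> z Hz [nN Ez]; apply: contrapT => nu; apply: nN; apply: NS => /=.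
  move=> /(_ (conj Hz Ez)) [] /eqP; rewrite subr_eq0 => /eqP cu.
  exact: nu.
Qed.

End bounded_integrals.

(** * Almost sure properties of outcome laws and bounds on payoffs *)

Section outcome_consequences.
Variables (R : realType) (n : nat) (G : game R n).

Local Notation prehistory := (prehistory G).
Local Notation history := (history (act G)).
Local Notation Hinf := (Hinf (act G)).
Local Notation moves k := (joint_action G k * chance G k.+1)%type.

Lemma measurable_Hinf : measurable (Hinf : set (borel (plays G))).
Proof. by apply: borel_closed; exact: closed_Hinf. Qed.

Lemma measurable_utility i :
  measurable_fun (Hinf : set (borel (plays G))) (utility G i : borel (plays G) -> R).
Proof.
apply: borel_within_continuous_real; first exact: closed_Hinf.
exact: utility_continuous.
Qed.

Section fixed_law.
Variables (p : profile G) (t : nat) (h : prehistory t) (tau : prob R (plays G)).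
Arguments p : clear implicits.
Hypotheses (pp : is_profile p) (Hh : history t h) (law : is_outcome_law p h tau).

Lemma outcome_Hinf : tau Hinf = 1%E. Proof. by case: law. Qed.

Lemma outcome_start : tau [set z | trunc z t = h] = 1%E.
Proof.
have [_ [taus [nus [tt _ _ tk]]]] := law.
have mh : measurable ([set h] : set (borel (prehistory t))).
  by apply: borel_closed; exact: closed1_prehistory.
rewrite -[mkset _]/((fun z => trunc z t) @^-1` [set h]) tk // tt //.
by rewrite /dirac_prob /= diracE mem_set.
Qed.

Lemma measurable_start :
  measurable ([set z | trunc z t = h] : set (borel (plays G))).
Proof.
apply: (@trunc_measurable R n G t [set h]).
by apply: borel_closed; exact: closed1_prehistory.
Qed.

Lemma outcome_full k (C : set (prehistory k.+1)) : (t <= k)%N -> closed C ->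
  (forall h' (m : moves k), history k h' ->
    (forall i, measure_support (p i k h') (m.1 i)) -> C (h', m)) ->
  tau ((fun z => trunc z k.+1) @^-1` C) = 1%E.
Proof.
have [_ [taus [nus [tt prod comp tk]]]] := law => le_tk cC hC.
rewrite tk //; [|exact: leqW|exact: borel_closed].
apply: (composition_full pp _ (comp k le_tk) cC hC) => h' Hh'.
exact: prod.
Qed.

Lemma measurable_first (B : forall i, set (borel (action G t i))) :
  (forall i, measurable (B i)) ->
  measurable ([set z | trunc z t = h /\
    forall i, B i ((z.1 t.+1 : joint_action G t) i)] : set (borel (plays G))).
Proof.
move=> mB; have mW := @fst_measurable (joint_action G t) (chance G t.+1) _
  (@measurable_full_box n (action G t) B mB).
have m2 : measurable ((snd : prehistory t.+1 -> moves t) @^-1`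
    ([set x : joint_action G t | forall i, B i (x i)] `*` setT)
    : set (borel (prehistory t.+1))).
  rewrite -[X in measurable X]setTI.
  by apply: (@borel_continuous (prehistory t * moves t)%type (moves t) snd) => // z;
    exact: cvg_snd.
rewrite (_ : mkset _ = [set z | trunc z t = h] `&`
    (fun z => trunc z t.+1) @^-1` ((snd : prehistory t.+1 -> moves t) @^-1`
      ([set x : joint_action G t | forall i, B i (x i)] `*` setT))).
  by apply: measurableI; [exact: measurable_start|exact: trunc_measurable].
by apply/seteqP; split=> z /= [? ]; [|case]; split.
Qed.

(** The marginal at stage [t] is the Dirac measure at [h], so the composition integral reduces to
    the one product measure [nus t h]. *)
Lemma outcome_first (B : forall i, set (borel (action G t i))) :
  (forall i, measurable (B i)) ->
  tau [set z | trunc z t = h /\ forall i, B i ((z.1 t.+1 : joint_action G t) i)] =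
  (\prod_(i < n) p i t h (B i))%E.
Proof.
move=> mB; have [_ [taus [nus [tt prod comp tk]]]] := law.
have mh : measurable ([set h] : set (borel (prehistory t))).
  by apply: borel_closed; exact: closed1_prehistory.
pose W : set (borel (moves t)) :=
  [set x : joint_action G t | forall i, B i (x i)] `*` setT.
have mW : measurable W.
  by apply: fst_measurable; exact: (@measurable_full_box n (action G t)).
have mhW : measurable ([set h] `*` W : set (borel (prehistory t.+1))).
  rewrite (_ : [set h] `*` W = ([set h] `*` setT) `&` snd @^-1` W); last first.
    by apply/seteqP; split=> [[x y] []|[x y] [[? _] ?]].
  apply: measurableI; first exact: fst_measurable.
  rewrite -[X in measurable X]setTI.
  by apply: (@borel_continuous (prehistory t * moves t)%type (moves t) snd) => // z;
    exact: cvg_snd.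
transitivity (tau ((fun z => trunc z t.+1) @^-1` ([set h] `*` W))).
  by congr (tau _); apply/seteqP; split=> z /= [] ? => [|[]]; split.
rewrite tk // comp // (_ : [set h] `&` history t = [set h]); last first.
  by apply/seteqP; split=> [x []|x ->].
rewrite (_ : (\int[_]_(x in _) _)%E =
    (\int[taus t]_(x in [set h]) cst (nus t h W) x)%E); last first.
  by apply: eq_integral => x; rewrite inE => ->.
rewrite integral_cst // (_ : (taus t : {measure set _ -> \bar R}) [set h] = 1%E).
  by rewrite mule1 prod // probability_setT mule1.
have : taus t [set h] = 1%E by rewrite tt // /dirac_prob /= diracE mem_set.
by [].
Qed.

(** A pathwise substitute for a supermartingale argument. Since [phi] is continuous, the histories
    at which it has not increased over the last stage form a closed set; that set contains all moves
    in the supports, so each further stage discards a null set only. *)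
Lemma outcome_monotone s (phi : forall k, prehistory k -> R) : (t <= s)%N ->
  (forall k, (s <= k)%N -> {within history k, continuous (phi k)}) ->
  (forall k h' (m : moves k), (s <= k)%N -> history k h' ->
    (forall i, measure_support (p i k h') (m.1 i)) ->
    phi k.+1 (h', m) <= phi k h') ->
  forall d, exists E : set (borel (plays G)), [/\ measurable E, tau E = 1%E &
    forall z, Hinf z -> E z ->
      phi (s + d)%N (trunc z (s + d)) <= phi s (trunc z s)].
Proof.
move=> ts cphi le_phi; elim=> [|d [E [mE tauE hE]]].
  by exists setT; split => // [|z _ _]; rewrite ?probability_setT ?addn0.
pose k := (s + d)%N; have sk : (s <= k)%N by exact: leq_addr.
pose psi (h' : prehistory k.+1) : R := phi k.+1 h' - phi k h'.1.
have cpsi : {within history k.+1, continuous psi}.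
  apply: within_continuous_ultra => x F Hx FU FH Fx.
  have FF : ProperFilter F by exact: ultra_proper.
  apply: cvgB.
    exact: (within_continuous_cvg (p := id) _ (cphi k.+1 (leqW sk)) Fx).
  apply: (within_continuous_cvg (p := fst) _ (cphi k sk)).
  - by move=> V hV; apply: Fx; exact: (cvg_fst hV).
  - by case: Hx.
  - by apply: filterS FH => y [].
pose C := history k.+1 `&` psi @^-1` [set r | r <= 0].
have cC : closed C.
  by apply: closed_within_preimage => //; exact: closed_history.
exists (E `&` (fun z => trunc z k.+1) @^-1` C); split.
- apply: measurableI => //; apply: (@trunc_measurable R n G).
  exact: borel_closed.
- apply: probability_eq1I => //.
    by apply: (@trunc_measurable R n G); exact: borel_closed.
  apply: outcome_full => //; first exact: leq_trans sk.
  move=> h' m Hh' hm; split; first exact: history_support pp Hh' hm.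
  by rewrite /psi /= subr_le0; exact: le_phi.
- move=> z Hz [Ez [_]]; rewrite /psi /= subr_le0 addnS => /le_trans; apply.
  exact: hE.
Qed.

End fixed_law.

Hypothesis hnat : without_nature G.
Variable T0 : nat.
Hypothesis hT0 : forall t, (T0 <= t)%N -> forall (h : prehistory t), history t h ->
  forall i, single_point (act G t i h).

Lemma outcome_lawP (p : profile G) t (h : prehistory t) :
  is_profile p -> history t h -> is_outcome_law p h (outcome_law p h).
Proof. move=> pp Hh; exact: (getPex (outcome_law_exists hnat hT0 pp Hh)). Qed.

Lemma payoff_le (p : profile G) t (h : prehistory t) i c
    (E : set (borel (plays G))) :
  is_profile p -> history t h -> measurable E -> outcome_law p h E = 1%E ->
  (forall z, Hinf z -> E z -> utility G i z <= c) -> payoff p i h <= c.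
Proof.
move=> pp Hh mE PE.
apply: (@Rintegral_le_const _ (borel (plays G)) R (outcome_law p h)
  Hinf E (utility G i) c) => //.
- exact: measurable_Hinf.
- exact: outcome_Hinf (outcome_lawP pp Hh).
- exact: measurable_utility.
- exact: utility_bounded.
Qed.

Lemma payoff_ge (p : profile G) t (h : prehistory t) i c
    (E : set (borel (plays G))) :
  is_profile p -> history t h -> measurable E -> outcome_law p h E = 1%E ->
  (forall z, Hinf z -> E z -> c <= utility G i z) -> c <= payoff p i h.
Proof.
move=> pp Hh mE PE.
apply: (@Rintegral_ge_const _ (borel (plays G)) R (outcome_law p h)
  Hinf E (utility G i) c) => //.
- exact: measurable_Hinf.
- exact: outcome_Hinf (outcome_lawP pp Hh).
- exact: measurable_utility.
- exact: utility_bounded.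
Qed.

Lemma payoff_eq (p : profile G) t (h : prehistory t) i c
    (E : set (borel (plays G))) :
  is_profile p -> history t h -> measurable E -> outcome_law p h E = 1%E ->
  (forall z, Hinf z -> E z -> utility G i z = c) -> payoff p i h = c.
Proof.
move=> pp Hh mE PE uc; apply/eqP; rewrite eq_le.
rewrite (payoff_le pp Hh mE PE) => [|z Hz Ez]; last by rewrite uc.
by rewrite (payoff_ge pp Hh mE PE) // => z Hz Ez; rewrite uc.
Qed.

(** A random variable almost surely bounded by its mean almost surely equals it. This turns the
    absence of profitable deviations into optimality of almost every move. *)
Lemma payoff_attained (p : profile G) t (h : prehistory t) i
    (E : set (borel (plays G))) :
  is_profile p -> history t h -> measurable E -> outcome_law p h E = 1%E ->
  (forall z, Hinf z -> E z -> utility G i z <= payoff p i h) ->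
  exists F : set (borel (plays G)),
    [/\ measurable F, outcome_law p h F = 1%E &
      forall z, Hinf z -> F z -> utility G i z = payoff p i h].
Proof.
move=> pp Hh mE PE uc.
apply: (@Rintegral_eq_const _ (borel (plays G)) R (outcome_law p h)
  Hinf E (utility G i) (payoff p i h)) => //.
- exact: measurable_Hinf.
- exact: outcome_Hinf (outcome_lawP pp Hh).
- exact: measurable_utility.
- exact: utility_bounded.
Qed.

Lemma payoff_continuation (p : profile G) t (h : prehistory t) i :
  is_profile p -> (T0 <= t)%N -> history t h ->
  payoff p i h = utility G i (continuation h).
Proof.
move=> pp Tt Hh.
apply: (payoff_eq pp Hh (measurable_start h) (outcome_start (outcome_lawP pp Hh))).
by move=> z Hz /= <-; rewrite (continuation_trunc hnat hT0 Tt).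
Qed.

End outcome_consequences.

(** * Equilibrium values *)

Lemma support_dirac (R : realType) (T : ptopologicalType) (x : T) :
  closed [set x] -> measure_support (dirac_prob R x) `<=` [set x].
Proof.
by move=> cx y /(_ _ cx); apply; rewrite /dirac_prob /= diracE mem_set.
Qed.

Section equilibrium_values.
Variables (R : realType) (n : nat) (G : game R n).

Local Notation prehistory := (prehistory G).
Local Notation history := (history (act G)).
Local Notation Hinf := (Hinf (act G)).
Local Notation moves k := (joint_action G k * chance G k.+1)%type.

Lemma closed1_action t i (x : action G t i) : closed [set x].
Proof. exact/(@metrizable_closed1 R)/polish_metrizable/action_polish. Qed.

Lemma closed_act t i (h : prehistory t) : history t h -> closed (act G t i h).
Proof.
move=> Hh; have [d md] := polish_metrizable (@action_polish _ _ G t i).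
by apply: compact_closed (metrizes_hausdorff md) _; exact: act_compact.
Qed.

Lemma support_nonempty t i (mu : prob R (action G t i)) :
  measure_support mu !=set0.
Proof.
have [W bW] := polish_countable_base (@action_polish _ _ G t i).
exact: probability_eq1_nonempty (support_eq1 mu bW).
Qed.

(** The change is confined to one history, a closed set, so measurability survives and the play
    after stage [t] still follows [fi]. *)
Definition one_shot i (fi : strategy_map G i) t (h : prehistory t)
    (y : action G t i) : strategy_map G i :=
  dfwith fi t (fun h' => if `[< h' = h >] then dirac_prob R y else fi t h').

Lemma one_shot_strategy i (fi : strategy_map G i) t (h : prehistory t) y :
  is_strategy fi -> act G t i h y -> is_strategy (one_shot fi h y).
Proof.
move=> sfi Ay k; rewrite /one_shot; case: dfwithP => [|{}k _]; last exact: sfi.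
have [mfi ifi] := sfi t; split=> [|h' Hh'].
  have mh : measurable ([set h] : set (borel (prehistory t))).
    by apply: borel_closed; exact: closed1_prehistory.
  have mH : measurable (history t : set (borel (prehistory t))).
    by apply: borel_closed; exact: closed_history.
  apply: measurable_fun_if => //.
    apply: (measurable_fun_bool true).
    rewrite (_ : _ @^-1` _ = [set h]); first exact: measurableI.
    by apply/seteqP; split=> h' /=; [move/asboolP|move/asboolP].
  by apply: measurable_funS mfi => //; exact: subIsetl.
case: ifPn => [/asboolP ->|_]; last exact: ifi.
by move=> y' /(support_dirac (@closed1_action _ _ _)) ->.
Qed.

Lemma is_profile_dfwith (p : profile G) i (fi : strategy_map G i) :
  is_profile p -> is_strategy fi -> is_profile (dfwith p i fi).
Proof. by move=> pp sfi j; case: dfwithP. Qed.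

Hypothesis hnat : without_nature G.
Variable T0 : nat.
Hypothesis hT0 : forall t, (T0 <= t)%N -> forall (h : prehistory t), history t h ->
  forall i, single_point (act G t i h).
Hypothesis hperf : perfect_information G.
Hypothesis hind : no_indifference G.

Lemma move_eq t (m m' : moves t) : (forall i, m.1 i = m'.1 i) -> m = m'.
Proof.
case: m m' => [x s] [x' s'] /= xx'; rewrite (chance_unique hnat s s').
by congr (_, _); exact: functional_extensionality_dep.
Qed.

Variable f : profile G.
Arguments f : clear implicits.
Hypothesis hf : subgame_perfect_equilibrium f.

Let pf : is_profile f. Proof. by case: hf. Qed.

(** The invariant of the backward induction. The second clause makes no indifference applicable to
    payoffs of subgames. The last one keeps only the other players in their supports and does not
    name the mover, so it applies to a deviation of any player at any history. *)
Definition stage_values t :=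
  [/\ forall j, {within history t, continuous (fun h => payoff f j h)},
      forall h, history t h ->
        exists2 z, Hinf z & forall j, payoff f j h = utility G j z,
      forall h (m : moves t), history t h ->
        (forall i, measure_support (f i t h) (m.1 i)) ->
        forall j, payoff f j ((h, m) : prehistory t.+1) = payoff f j h
    & forall h (m : moves t) i, history t h -> act G t i h (m.1 i) ->
        (forall j, j != i -> measure_support (f j t h) (m.1 j)) ->
        payoff f i ((h, m) : prehistory t.+1) <= payoff f i h].

Lemma stage_values_ge t : (T0 <= t)%N -> stage_values t.
Proof.
move=> Tt.
have VE k j (h : prehistory k) : (T0 <= k)%N -> history k h ->
    payoff f j h = utility G j (continuation h).
  by move=> Tk Hh; exact: (payoff_continuation hnat hT0 j pf Tk Hh).
have next h (m : moves t) : history t.+1 (h, m) ->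
    forall j, payoff f j ((h, m) : prehistory t.+1) = payoff f j h.
  move=> Hhm j; have [Hh _] := Hhm; rewrite !VE //; last exact: leqW.
  have [Hc ct] := continuationP Hhm; congr (utility G j _).
  rewrite -[LHS](continuation_trunc hnat hT0 Tt) //; congr (continuation _).
  by case: ct.
split.
- move=> j; apply: within_continuous_ultra => h F Hh FU FH Fh.
  have FF : ProperFilter F by exact: ultra_proper.
  rewrite VE //.
  have : (utility G j \o @continuation _ _ G t) @ F --> utility G j (continuation h).
    have [Hc _] := continuationP Hh.
    apply: (within_continuous_cvg _ (@utility_continuous _ _ G j)) => //.
      apply: (within_continuous_cvg (p := id) _
        (continuation_continuous hnat hT0 Tt) Fh) => //.
    by apply: filterS FH => h' Hh'; have [] := continuationP Hh'.
  move=> c V hV.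
  have FV : F ((utility G j \o @continuation _ _ G t) @^-1` V) := c V hV.
  suff : F ((fun h' => payoff f j h') @^-1` V) by [].
  apply: filterS (filterI FH FV) => h' [Hh' Vh'].
  by rewrite /preimage /= VE.
- move=> h Hh; have [Hc _] := continuationP Hh.
  by exists (continuation h) => // j; exact: VE.
- by move=> h m Hh hm; apply: next; exact: history_support pf Hh hm.
- move=> h m i Hh Am hm; rewrite next //; split => // j /=.
  have [->//|/hm] := eqVneq j i.
  by have [_ /(_ h Hh)] := pf j t; apply.
Qed.

(** After stage [t] the value is constant along moves in the supports, so [outcome_monotone] applies
    to it and to its opposite. Stage [t.+1 + T0] is past the horizon, where value and utility
    coincide. Since [p] may differ from [f] at stage [t], one-shot deviations are covered. *)
Lemma tail_value (p : profile G) t (h : prehistory t) j :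
  is_profile p -> history t h ->
  (forall l k (h' : prehistory k), (t < k)%N -> p l k h' = f l k h') ->
  (forall k, (t < k)%N -> stage_values k) ->
  exists E : set (borel (plays G)),
    [/\ measurable E, outcome_law p h E = 1%E &
      forall z, Hinf z -> E z ->
        trunc z t = h /\ utility G j z = payoff f j (trunc z t.+1)].
Proof.
move=> pp Hh pf_eq sv; have law := outcome_lawP hnat hT0 pp Hh.
have [E1 [mE1 PE1 hE1]] : exists E : set (borel (plays G)), [/\ measurable E,
    outcome_law p h E = 1%E & forall z, Hinf z -> E z ->
    payoff f j (trunc z (t.+1 + T0)) <= payoff f j (trunc z t.+1)].
  apply: (outcome_monotone pp law (s := t.+1)
    (phi := fun k (h : prehistory k) => payoff f j h)) => // k.
    by move=> tk; have [cV _ _ _] := sv k tk; exact: cV.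
  move=> h' m tk Hh' hm; have [_ _ c1 _] := sv k tk.
  by rewrite c1 // => i; rewrite -pf_eq.
have [E2 [mE2 PE2 hE2]] : exists E : set (borel (plays G)), [/\ measurable E,
    outcome_law p h E = 1%E & forall z, Hinf z -> E z ->
    - payoff f j (trunc z (t.+1 + T0)) <= - payoff f j (trunc z t.+1)].
  apply: (outcome_monotone pp law (s := t.+1)
    (phi := fun k (h : prehistory k) => - payoff f j h)) => // k.
    move=> tk; have [cV _ _ _] := sv k tk.
    by apply/subspace_continuousP => x Hx; apply: cvgN;
      have /subspace_continuousP := cV j; exact.
  move=> h' m tk Hh' hm; have [_ _ c1 _] := sv k tk.
  by rewrite c1 // => i; rewrite -pf_eq.
exists ([set z | trunc z t = h] `&` (E1 `&` E2)); split.
- by apply: measurableI; [exact: measurable_start|exact: measurableI].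
- apply: probability_eq1I => //; [exact: measurable_start|exact: measurableI| |].
    exact: outcome_start law.
  exact: probability_eq1I.
- move=> z Hz [zh [E1z E2z]]; split => //.
  have Tk : (T0 <= t.+1 + T0)%N by exact: leq_addl.
  rewrite -[in LHS](continuation_trunc hnat hT0 Tk Hz).
  rewrite -(payoff_continuation hnat hT0 j pf Tk (Hz _)).
  by apply/eqP; rewrite eq_le hE1 //= -lerN2; exact: hE2.
Qed.

Section one_history.
Variables (t : nat) (h : prehistory t).
Hypotheses (sv : forall k, (t < k)%N -> stage_values k) (Hh : history t h).

Let V j (m : moves t) := payoff f j ((h, m) : prehistory t.+1).
Let A (m : moves t) := forall i, act G t i h (m.1 i).

Let AH m : A m -> history t.+1 (h, m). Proof. by split. Qed.

Let play_A z : Hinf z -> trunc z t = h -> A (z.1 t.+1, z.2 t.+1).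
Proof. by move=> Hz zh i; have [_ /(_ i)] := Hz t.+1; rewrite /= zh. Qed.

Let play_V z j : trunc z t = h ->
  payoff f j (trunc z t.+1) = V j (z.1 t.+1, z.2 t.+1).
Proof. by move=> /= ->. Qed.

Let support_A i y : measure_support (f i t h) y -> act G t i h y.
Proof. by have [_ /(_ h Hh)] := pf i t; apply. Qed.

Let V_play m : A m -> exists2 z, Hinf z & forall j, V j m = utility G j z.
Proof. by move=> /AH Am; have [_ + _ _] := sv (ltnSn t); apply. Qed.

Let indifference m m' i : A m -> A m' -> V i m = V i m' ->
  forall j, V j m = V j m'.
Proof.
move=> /V_play[z Hz Vz] /V_play[z' Hz' Vz'] Vi j.
rewrite Vz Vz'; apply: hind => //; exists i.
by rewrite -Vz -Vz'.
Qed.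

(* The last clause speaks of moves that no single player can improve upon:
   unlike moves in the supports, these are preserved by limits. *)
Definition history_values :=
  [/\ exists2 z, Hinf z & forall j, payoff f j h = utility G j z,
      forall m : moves t, (forall i, measure_support (f i t h) (m.1 i)) ->
        forall j, V j m = payoff f j h,
      forall (m : moves t) i, act G t i h (m.1 i) ->
        (forall j, j != i -> measure_support (f j t h) (m.1 j)) ->
        V i m <= payoff f i h
    & forall m : moves t, A m ->
        (forall i y, act G t i h y -> V i (dfwith m.1 i y, m.2) <= V i m) ->
        forall j, V j m = payoff f j h].

Lemma history_values_nomover :
  (forall i, single_point (act G t i h)) -> history_values.
Proof.
move=> sg; have eqA m m' : A m -> A m' -> m = m'.
  move=> Am Am'; apply: move_eq => i; have [y Ey] := sg i.
  by move: (Am i) (Am' i); rewrite Ey => -> ->.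
have VE m : A m -> forall j, V j m = payoff f j h.
  move=> Am j; have [E [mE PE hE]] := tail_value j pf Hh (fun _ _ _ _ => erefl) sv.
  apply/esym/(payoff_eq hnat hT0 pf Hh mE PE) => z Hz /(hE z Hz)[zh ->].
  by rewrite play_V //; congr (V j _); apply: eqA => //; exact: play_A.
split.
- have [z [Hz zh]] := history_extends Hh.
  have [z' Hz' Vz'] := V_play (play_A Hz zh).
  by exists z' => // j; rewrite -Vz' VE //; exact: play_A.
- by move=> m hm; apply: VE => i; exact: support_A.
- move=> m i Am hm; rewrite VE // => j.
  by have [->//|/hm/support_A] := eqVneq j i.
- by move=> m Am _; exact: VE.
Qed.

Lemma history_values_mover i : ~ single_point (act G t i h) -> history_values.
Proof.
move=> ni; have sg j (ji : j != i) := hperf Hh ni ji.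
(* Perfect information: the mover's action determines the whole move. *)
have eqA m m' : A m -> A m' -> m.1 i = m'.1 i -> m = m'.
  move=> Am Am' mm'; apply: move_eq => j; have [->//|ji] := eqVneq j i.
  have [y Ey] := sg j ji.
  by move: (Am j) (Am' j); rewrite Ey => -> ->.
have mC j (y : action G t j) : measurable ([set y] : set (borel _)).
  by apply: borel_closed; exact: closed1_action.
(* Only the mover is constrained; the other factors of the product measure equal one, which leaves
   the mover's probability of [C]. *)
pose B (C : set (action G t i)) : forall j, set (borel (action G t j)) :=
  dfwith (fun j => [set: action G t j]) i C.
have mB C : measurable (C : set (borel (action G t i))) ->
    forall j, measurable (B C j).
  by move=> ? j; rewrite /B; case: dfwithP.
have prodB (p : profile G) C :
    (\prod_(j < n) p j t h (B C j))%E = p i t h C.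
  rewrite (bigD1 i) //= big1 ?mule1 /B ?dfwithin // => j ji.
  by rewrite dfwithout 1?eq_sym // probability_setT.
(* The one-shot deviation to [m.1 i] almost surely leads to the move [m], after which [f] is
   followed, so it is worth exactly [V i m]. *)
have dev m : A m -> V i m <= payoff f i h.
  move=> Am; pose fi' := one_shot (f i) h (m.1 i).
  have sfi' : is_strategy fi' by exact: one_shot_strategy (pf i) (Am i).
  have pp := is_profile_dfwith pf sfi'.
  have peq l k (h' : prehistory k) : (t < k)%N -> dfwith f i fi' l k h' = f l k h'.
    move=> tk; case: dfwithP => // .
    by rewrite /fi' /one_shot dfwithout // ltn_eqF.
  have [E [mE PE hE]] := tail_value i pp Hh peq sv.
  have law := outcome_lawP hnat hT0 pp Hh.
  have mF := measurable_first h (mB _ (mC _ (m.1 i))).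
  have PF := outcome_first Hh law (mB _ (mC _ (m.1 i))).
  have {}PF : outcome_law (dfwith f i fi') h [set z | trunc z t = h /\
      forall j, B [set m.1 i] j ((z.1 t.+1 : joint_action G t) j)] = 1%E.
    rewrite PF prodB dfwithin /fi' /one_shot dfwithin ifT; last exact/asboolP.
    by rewrite /dirac_prob /= diracE mem_set.
  suff <- : payoff (dfwith f i fi') i h = V i m by case: hf => _; apply.
  apply: (payoff_eq hnat hT0 pp Hh (measurableI _ _ mE mF)
    (probability_eq1I mE mF PE PF)).
  move=> z Hz [Ez [zh]] /(_ i); rewrite /B dfwithin /= => zi.
  have [_ ->] := hE z Hz Ez; rewrite play_V //; congr (V i _).
  by apply: eqA => //; exact: play_A.
have law := outcome_lawP hnat hT0 pf Hh.
have tail j := tail_value j pf Hh (fun _ _ _ _ => erefl) sv.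
have [F [mF PF hF]] : exists F : set (borel (plays G)),
    [/\ measurable F, outcome_law f h F = 1%E & forall z, Hinf z -> F z ->
      trunc z t = h /\ V i (z.1 t.+1, z.2 t.+1) = payoff f i h].
  have [E [mE PE hE]] := tail i.
  have [|F [mF PF hF]] := payoff_attained (i := i) hnat hT0 pf Hh mE PE.
    move=> z Hz /(hE z Hz)[zh ->]; rewrite play_V //.
    by apply: dev; exact: play_A.
  exists (E `&` F); split; first exact: measurableI.
    exact: probability_eq1I.
  move=> z Hz [/(hE z Hz)[zh zV] /(hF z Hz) <-]; split => //.
  by rewrite -play_V // -zV.
(* The actions of the players other than [i] are forced, and coordinate [i] is always
   overwritten. *)
pose a : joint_action G t := fun j => get (act G t j h).
have Aa y : act G t i h y -> A (dfwith a i y, point).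
  move=> Ay j /=; case: dfwithP => // l _.
  by apply: getPex; exact: act_nonempty Hh.
pose C := act G t i h `&`
  (fun y => V i (dfwith a i y, point)) @^-1` [set payoff f i h].
have cC : closed C.
  apply: closed_within_preimage; first exact: closed_act.
    apply: within_continuous_ultra => y W Ay WU WA Wy.
    have [cV _ _ _] := sv (ltnSn t).
    have WF : ProperFilter W by exact: ultra_proper.
    apply: (within_continuous_cvg
      (p := fun y => (h, (dfwith a i y, point)) : prehistory t.+1) _ (cV i)).
    - have c1 : (fun y => dfwith a i y : joint_action G t) @ W -->
          (dfwith a i y : joint_action G t).
        move=> U hU; apply: (Wy ((fun y => dfwith a i y) @^-1` U)).
        exact: (@dfwith_continuous _ (action G t) a i y U hU).
      exact: (cvg_pair (cvg_cst h) (cvg_pair c1 (cvg_cst point))).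
    - by apply: AH; exact: Aa.
    - by apply: filterS WA => y' Ay'; apply: AH; exact: Aa.
  exact: closed_eq.
have PC : f i t h C = 1%E.
  have mC' := borel_closed cC.
  rewrite -prodB -(outcome_first Hh law (mB _ mC')).
  apply: (@probability_eq1S _ (borel (plays G)) R (outcome_law f h)
    (Hinf `&` F)).
  - by apply: measurableI => //; exact: measurable_Hinf.
  - exact: measurable_first (mB _ mC').
  - move=> z [Hz /(hF z Hz)[zh zV]]; split => // j; rewrite /B.
    case: dfwithP => //; have Az := play_A Hz zh; split; first exact: Az.
    rewrite /preimage /= -zV; congr (V i _); apply: eqA => //=.
      by apply: Aa; exact: Az.
    by rewrite dfwithin.
  - apply: probability_eq1I => //; first exact: measurable_Hinf.
    exact: outcome_Hinf law.
have suppV m : A m -> measure_support (f i t h) (m.1 i) -> V i m = payoff f i h.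
  move=> Am /(_ C cC PC)[Ami <-]; congr (V i _); apply: eqA => //=.
    exact: Aa.
  by rewrite dfwithin.
have [y /(_ C cC PC)[Ay yV]] := support_nonempty (f i t h).
pose m0 : moves t := (dfwith a i y, point).
have Am0 : A m0 by exact: Aa.
have V0 : V i m0 = payoff f i h by [].
have VE j : V j m0 = payoff f j h.
  have [E [mE PE hE]] := tail j.
  apply/esym/(payoff_eq hnat hT0 pf Hh (measurableI _ _ mE mF)
    (probability_eq1I mE mF PE PF)).
  move=> z Hz [/(hE z Hz)[zh ->] /(hF z Hz)[_ zV]]; rewrite play_V //.
  by apply: (indifference (i := i)) => //; [exact: play_A|rewrite zV].
have eqV m : A m -> V i m = payoff f i h -> forall j, V j m = payoff f j h.
  by move=> Am Vm j; rewrite -VE; apply: (indifference (i := i)); rewrite ?V0.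
split.
- have [z Hz zV] := V_play Am0.
  by exists z => // j; rewrite -VE.
- by move=> m hm; have Am : A m := fun j => support_A (hm j); exact/eqV/suppV.
- move=> m j Amj hm.
  have Am : A m by move=> l; have [->//|/hm/support_A] := eqVneq l j.
  have [->|ji] := eqVneq j i; first exact: dev.
  by rewrite eqV // suppV //; apply: hm; rewrite eq_sym.
(* A move that the mover cannot improve upon is worth at least the support move [m0], hence exactly
   the value of [h]. *)
- move=> m Am nash; apply: eqV => //; apply/eqP; rewrite eq_le dev //= -V0.
  rewrite (_ : m0 = (dfwith m.1 i y, m.2)); first exact: nash.
  apply: eqA => //=; last by rewrite !dfwithin.
  by move=> j /=; case: dfwithP.
Qed.

Lemma history_valuesP : history_values.
Proof.
have [[i]|/forallNP sg] := pselect (exists i, ~ single_point (act G t i h)).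
  exact: history_values_mover.
by apply: history_values_nomover => i; exact: contrapT.
Qed.

End one_history.

(** All clauses but continuity are [history_valuesP]. For continuity, the values near [h] are those
    of moves [x h'] in the supports. Their limit [a] may leave the supports at [h], but no player
    can improve upon it, and the last clause of [history_values] then gives it the value of [h]. *)
Lemma stage_values_step t : (forall k, (t < k)%N -> stage_values k) ->
  stage_values t.
Proof.
move=> sv; have [svC _ _ _] := sv t.+1 (ltnSn t).
have hv h (Hh : history t h) := history_valuesP sv Hh.
have c1 h (m : moves t) : history t h ->
    (forall i, measure_support (f i t h) (m.1 i)) ->
    forall j, payoff f j ((h, m) : prehistory t.+1) = payoff f j h.
  by move=> Hh; have [_ c _ _] := hv h Hh; exact: c.
have c2 h (m : moves t) i : history t h -> act G t i h (m.1 i) ->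
    (forall j, j != i -> measure_support (f j t h) (m.1 j)) ->
    payoff f i ((h, m) : prehistory t.+1) <= payoff f i h.
  by move=> Hh; have [_ _ c _] := hv h Hh; exact: c.
split => //; last by move=> h Hh; have [] := hv h Hh.
move=> j; apply: within_continuous_ultra => h F Hh FU FH Fh.
have FF : ProperFilter F by exact: ultra_proper.
pose x h' : joint_action G t := fun i => get (measure_support (f i t h')).
have xP h' i : measure_support (f i t h') (x h' i).
  by apply: getPex; exact: support_nonempty.
have xA h' i : history t h' -> act G t i h' (x h' i).
  by move=> Hh'; have [_ /(_ h' Hh')] := pf i t; apply.
have lim i : exists2 y, act G t i h y & (fun h' => x h' i) @ F --> y.
  apply: (uhc_ultra_cvg FU (@act_uhc _ _ G t i) _ Hh Fh).
    exact: act_compact Hh.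
  by apply: filterS FH => h' Hh'; split => //; exact: xA.
pose a : joint_action G t := fun i => projT1 (cid2 (lim i)).
have Aa i : act G t i h (a i) by rewrite /a; case: cid2.
have xa : x @ F --> a.
  apply: (@cvg_prod_topology _ (action G t)) => i.
  by rewrite /a; case: cid2.
pose w (h' : prehistory t) (y : joint_action G t) : prehistory t.+1 :=
  (h', (y, point)).
have VxE h' i : history t h' -> payoff f i (w h' (x h')) = payoff f i h'.
  by move=> Hh'; apply: c1.
have Vx i : (fun h' => payoff f i (w h' (x h'))) @ F --> payoff f i (w h a).
  apply: (within_continuous_cvg (p := fun h' => w h' (x h')) _ (svC i)).
  - exact: (cvg_pair Fh (cvg_pair xa (cvg_cst point))).
  - by split.
  - by apply: filterS FH => h' Hh'; split => // l; exact: xA.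
have nash i y : act G t i h y ->
    payoff f i (w h (dfwith a i y)) <= payoff f i (w h a).
  move=> Ay; rewrite leNgt; apply/negP => lt.
  (* A profitable deviation [y] at [h] leaves room for a threshold [r] strictly between the two
     payoffs. Lower hemicontinuity carries [y] to feasible deviations [y'] at nearby histories that
     pay more than [r]. *)
  pose r := (payoff f i (w h a) + payoff f i (w h (dfwith a i y))) / 2.
  have [rlt ltr] : payoff f i (w h a) < r /\ r < payoff f i (w h (dfwith a i y)).
    by have [] := midf_lt lt.
  pose Psi (b : (prehistory t * joint_action G t) * action G t i) :=
    w b.1.1 (dfwith b.1.2 i b.2).
  have cPsi : {for ((h, a), y), continuous Psi}.
    have cd : (fun b : (prehistory t * joint_action G t) * action G t i =>
        dfwith b.1.2 i b.2 : joint_action G t) @ nbhs ((h, a), y) -->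
        (dfwith a i y : joint_action G t).
      apply: (@cvg_comp _ _ _
        (fun b : (prehistory t * joint_action G t) * action G t i =>
          (b.1.2, b.2) : joint_action G t * action G t i)
        (fun b : joint_action G t * action G t i =>
          dfwith b.1 i b.2 : joint_action G t) _ (nbhs (a, y))).
        have c12 : (fun b : (prehistory t * joint_action G t) * action G t i =>
            b.1.2) @ nbhs ((h, a), y) --> a.
          apply: (@cvg_comp _ _ _ fst snd _ (nbhs (h, a))); first exact: cvg_fst.
          exact: cvg_snd.
        exact: (cvg_pair c12 cvg_snd).
      exact: (@dfwith2_continuous _ (action G t) i (a, y)).
    have c1' : (fun b : (prehistory t * joint_action G t) * action G t i => b.1.1)
        @ nbhs ((h, a), y) --> h.
      apply: (@cvg_comp _ _ _ fst fst _ (nbhs (h, a))); first exact: cvg_fst.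
      exact: cvg_fst.
    exact: (cvg_pair c1' (cvg_pair cd (cvg_cst point))).
  have Hwy : history t.+1 (w h (dfwith a i y)).
    by split => // l; rewrite /w /=; case: dfwithP.
  have N : nbhs (Psi ((h, a), y))
      [set v | history t.+1 v -> r < payoff f i v].
    exact: (iffLR (@subspace_continuousP _ _ _ _) (svC i) _ Hwy [set s | r < s]
      (open_nbhs_nbhs (conj (@open_gt R r) ltr))).
  have [[P Q] /= [Pha Qy] PQ] := cPsi _ N.
  have FP : F [set h' | P (h', x h')] by exact: (cvg_pair Fh xa Pha).
  move: Qy; rewrite nbhsE => -[Q' [oQ' Q'y] Q'Q].
  have FQ : F [set h' | history t h' -> act G t i h' `&` Q' !=set0].
    by apply: Fh; apply: (@act_lhc _ _ G t i h Hh Q' oQ'); exists y.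
  (* At [h'] the deviation [y'] pays at most the value of [h'], by [c2], and this value is what
     [x h'] yields. Hence [r] bounds these values from below, and so also their limit, against
     [rlt]. *)
  have Fr : F [set h' | r <= payoff f i (w h' (x h'))].
    have FI : F (history t `&` ([set h' | P (h', x h')] `&`
        [set h' | history t h' -> act G t i h' `&` Q' !=set0])).
      by apply: filterI => //; exact: filterI.
    apply: filterS FI => h' [Hh' [Ph' /(_ Hh')[y' [Ay' Qy']]]].
    have Hw : history t.+1 (w h' (dfwith (x h') i y')).
      by split => // l; rewrite /w /=; case: dfwithP => // l' _; exact: xA.
    rewrite /= VxE //; apply: ltW.
    apply: (lt_le_trans (PQ ((h', x h'), y') (conj Ph' (Q'Q _ Qy')) Hw)).
    apply: c2 => //=; first by rewrite dfwithin.
    by move=> l li; rewrite dfwithout // eq_sym.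
  have : r <= payoff f i (w h a).
    exact: (@closed_cvg _ _ F FF (fun h' => payoff f i (w h' (x h')))
      [set s | r <= s] (@closed_ge R r) Fr _ (Vx i)).
  by rewrite leNgt rlt.
have [_ _ _ /(_ (a, point) Aa nash j) <-] := hv h Hh.
move=> U hU.
have FU' : F ((fun h' => payoff f j (w h' (x h'))) @^-1` U) := Vx j U hU.
suff : F ((fun h' => payoff f j h') @^-1` U) by [].
apply: filterS (filterI FH FU') => h' [Hh' Uh'].
by rewrite /preimage /= -VxE.
Qed.

End equilibrium_values.

(** * Comparison of other profiles with the equilibrium values *)

Section no_mixing_proof.
Variables (R : realType) (n : nat) (G : game R n).

Local Notation prehistory := (prehistory G).
Local Notation history := (history (act G)).
Local Notation Hinf := (Hinf (act G)).
Local Notation moves k := (joint_action G k * chance G k.+1)%type.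

Hypothesis hnat : without_nature G.
Variable T0 : nat.
Hypothesis hT0 : forall t, (T0 <= t)%N -> forall (h : prehistory t), history t h ->
  forall i, single_point (act G t i h).
Hypothesis hperf : perfect_information G.
Hypothesis hind : no_indifference G.

Variable f : profile G.
Arguments f : clear implicits.
Hypothesis hf : subgame_perfect_equilibrium f.

Let pf : is_profile f. Proof. by case: hf. Qed.

Lemma stage_valuesP t : stage_values f t.
Proof.
(* The induction is on a bound [d] for the distance to the horizon, because a step uses all later
   stages and not only the next. *)
have [d] : exists d, (T0 <= t + d)%N by exists T0; exact: leq_addl.
elim: d t => [|d IHd] t Td.
  by apply: (stage_values_ge hnat hT0 hf); rewrite -(addn0 t).
apply: (stage_values_step hnat hT0 hperf hind hf) => k tk; apply: IHd.
by apply: leq_trans Td _; rewrite addnS -addSn leq_add2r.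
Qed.

(** The verification principle of dynamic programming: if the equilibrium value does not increase
    along the moves of [p], the utility reached is almost surely at most the value at [h]. After
    [T0] further stages the horizon is passed, where value and utility agree. *)
Lemma payoff_le_value (p : profile G) t (h : prehistory t) i :
  is_profile p -> history t h ->
  (forall k (h' : prehistory k) (m : moves k), history k h' ->
    (forall j, measure_support (p j k h') (m.1 j)) ->
    payoff f i ((h', m) : prehistory k.+1) <= payoff f i h') ->
  payoff p i h <= payoff f i h.
Proof.
move=> pp Hh le; have law := outcome_lawP hnat hT0 pp Hh.
have [|k h' m _|E [mE PE hE]] := outcome_monotone pp law (leqnn t)
  (phi := fun k (h : prehistory k) => payoff f i h) _ _ T0.
- by move=> k _; have [c _ _ _] := stage_valuesP k; exact: c.
- exact: le.
apply: (payoff_le hnat hT0 pp Hh (measurableI _ _ mE (measurable_start h))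
  (probability_eq1I mE (measurable_start h) PE (outcome_start law))).
move=> z Hz [Ez zh]; have := hE z Hz Ez.
have Tk : (T0 <= t + T0)%N by exact: leq_addl.
rewrite (payoff_continuation hnat hT0 i pf Tk (Hz _)).
by rewrite (continuation_trunc hnat hT0 Tk Hz) zh.
Qed.

Lemma payoff_ge_value (p : profile G) t (h : prehistory t) i :
  is_profile p -> history t h ->
  (forall k (h' : prehistory k) (m : moves k), history k h' ->
    (forall j, measure_support (p j k h') (m.1 j)) ->
    payoff f i h' <= payoff f i ((h', m) : prehistory k.+1)) ->
  payoff f i h <= payoff p i h.
Proof.
move=> pp Hh ge; have law := outcome_lawP hnat hT0 pp Hh.
have [|k h' m _ Hh' hm|E [mE PE hE]] := outcome_monotone pp law (leqnn t)
  (phi := fun k (h : prehistory k) => - payoff f i h) _ _ T0.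
- move=> k _; have [c _ _ _] := stage_valuesP k.
  by apply/subspace_continuousP => x Hx; apply: cvgN;
    have /subspace_continuousP := c i; exact.
- by rewrite lerN2; exact: ge.
apply: (payoff_ge hnat hT0 pp Hh (measurableI _ _ mE (measurable_start h))
  (probability_eq1I mE (measurable_start h) PE (outcome_start law))).
move=> z Hz [Ez zh]; have := hE z Hz Ez.
have Tk : (T0 <= t + T0)%N by exact: leq_addl.
rewrite (payoff_continuation hnat hT0 i pf Tk (Hz _)).
by rewrite (continuation_trunc hnat hT0 Tk Hz) zh lerN2.
Qed.

Lemma no_mixing_spe : no_mixing f.
Proof.
move=> g pg gf; split => // i t h Hh fi' sfi'.
have gE j k (h' : prehistory k) y :
    measure_support (@mixed_of_pure R n G g j k h') y -> y = g j k h'.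
  by move=> /(support_dirac (@closed1_action _ _ _ _ _ _)).
(* The equilibrium value separates the two payoffs. Against [g] the opponents of [i] stay in the
   supports of [f], so deviations earn at most this value; under [g] itself every move is in the
   supports, so [g] earns at least as much. *)
apply: (@le_trans _ _ (payoff f i h)).
  apply: payoff_le_value => //; first exact: is_profile_dfwith.
  move=> k h' m Hh' hm; have [_ _ _ c2] := stage_valuesP k.
  apply: c2 => // [|j ji].
    have := hm i; rewrite dfwithin.
    by have [_ /(_ h' Hh')] := sfi' k; apply.
  have := hm j; rewrite dfwithout 1?eq_sym // => /gE ->.
  exact: gf.
apply: payoff_ge_value => // k h' m Hh' hm.
have [_ _ c1 _] := stage_valuesP k.
by rewrite c1 // => j; rewrite (gE _ _ _ _ (hm j)); exact: gf.
Qed.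

End no_mixing_proof.

Theorem theorem2 (R : realType) (n : nat) (G : game R n)
    (hfin : finite_horizon G) (hperf : perfect_information G)
    (hnat : without_nature G) (hind : no_indifference G)
    (f : profile G) (hf : subgame_perfect_equilibrium f) :
  no_mixing f.
Proof.
have [T hT] := hfin.
exact: (no_mixing_spe hnat hT hperf hind hf).
Qed.
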